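(* Let $\mathcal{V}=V_0\cup\mathcal{W}$ be a 1-excess fusion frame for $\mathcal{H}$, where $\mathcal{W}=\{W_i\}_{i\in I}$ is a (1-uniform) fusion Riesz basis for $\mathcal{H}$, $0\notin I$, $V_0=\mathrm{span}\{x\}$, and $x=\sum_{i\in\sigma}x_i\in\mathcal{H}$ with $x_i\in W_i$ and $\sigma=\{i\in I : x_i\neq 0\}$. Let $U\in B(\mathcal{H})$ be invertible. Then the following are equivalent: (i) $\mathcal{V}$ is $(U,\gamma)$-scalable for some family of weights $\gamma=\{\gamma_i\}_{i\in I\cup\{0\}}$. (ii) There exist a partition $\{I_1,I_2\}$ of $I\cup\{0\}$ with $I_2\subseteq I$, vectors $\{f_i\}_{i\in I_1}$ and weights $\{\gamma_i\}_{i\in I_1}$ such that $$\mathcal{V}=\left\{\mathrm{span}\{f_i\}\right\}_{i\in I_1}\cup\left\{W_i\right\}_{i\in I_2},$$ $\mathrm{span}\{Uf_i\}_{i\in I_1}\oplus\mathrm{span}\{UW_i\}_{i\in I_2}=\mathcal{H}$ (orthogonal direct sum), and one of the following holds: (a) $\{Uf_i\}_{i\in I_1}$ is a strictly scalable 1-excess frame sequence with coefficients $\{\gamma_i\}_{i\in I_1}$, and $\{UW_i\}_{i\in I_2}$ is an orthogonal sequence of subspaces. (b) With $\mathcal{F}=\{f_i\}_{i\in I_1}$ and $\mathcal{W}'=\{W_i\}_{i\in I_2}$, $$U^*Uf=S_{\gamma\mathcal{F}}^{-1}f\quad\text{for } f\in\mathrm{span}\{Uf_i\}_{i\in I_1},\qquad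 U^*UW_i=S_{\mathcal{W}'}^{-1}W_i\quad\text{for } i\in I_2.$$
   Context: $\mathcal{H}$ is a separable Hilbert space, $B(\mathcal{H})$ the bounded operators on $\mathcal{H}$, $I$ a countable index set, $\pi_W$ the orthogonal projection onto a closed subspace $W$. A family of weights is a family of strictly positive numbers. For closed subspaces $W_i$ and weights $\omega_i$, $\{(W_i,\omega_i)\}_{i\in I}$ is a fusion frame for $\mathcal{H}$ if there are $0<A\le B<\infty$ with $A\|f\|^2\le\sum_{i}\omega_i^2\|\pi_{W_i}f\|^2\le B\|f\|^2$ for all $f\in\mathcal{H}$; it is Parseval if $A=B=1$ can be taken. It is 1-uniform, and written $\{W_i\}_{i\in I}$, if all $\omega_i=1$. Its fusion frame operator is $f\mapsto\sum_i\omega_i^2\pi_{W_i}f$; its synthesis operator is $\{f_i\}_i\mapsto\sum_i\omega_if_i$ on the $\ell^2$-direct sum of the $W_i$. The excess of a fusion frame (resp. of a frame sequence of vectors) is the dimension of the null space of its synthesis operator; ''1-excess'' means excess equal to $1$. $\{W_i\}_{i\in I}$ is a (1-uniform) fusion Riesz basis if the closed linear span of $\bigcup_iW_i$ is $\mathcal{H}$ and there are $C,D>0$ such that $C\sum_{j\in J}\|f_j\|^2\le\|\sum_{j\in J}f_j\|^2\le D\sum_{j\in J}\|f_j\|^2$ for every finite $J\subset I$ and all $f_j\in W_j$. The fusion frame $\mathcal{V}=V_0\cup\mathcal{W}$ is the 1-uniform family $\{V_i\}_{i\in I\cup\{0\}}$ with $V_i=W_i$ for $i\in I$. For an invertible $U\in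 B(\mathcal{H})$ and weights $\gamma=\{\gamma_i\}_{i\in I\cup\{0\}}$, $\mathcal{V}$ is $(U,\gamma)$-scalable if $\{(UV_i,\gamma_i)\}_{i\in I\cup\{0\}}$ is a Parseval fusion frame for $\mathcal{H}$. The equality $\mathcal{V}=\{\mathrm{span}\{f_i\}\}_{i\in I_1}\cup\{W_i\}_{i\in I_2}$ means $V_i=\mathrm{span}\{f_i\}$ for $i\in I_1$ and $V_i=W_i$ for $i\in I_2$. The span of a family of vectors or subspaces is its closed linear span. One of $I_1,I_2$ may be empty. A frame sequence is a sequence of vectors that is a frame for its closed linear span. A frame sequence $\{g_i\}_{i\in I_1}$ is strictly scalable with coefficients $\{\gamma_i\}_{i\in I_1}$ if all $\gamma_i>0$ and $\sum_{i\in I_1}\gamma_i^2\langle g,g_i\rangle g_i=g$ for all $g$ in its closed linear span. $\gamma\mathcal{F}=\{\gamma_if_i\}_{i\in I_1}$ and $S_{\gamma\mathcal{F}}f=\sum_{i\in I_1}\gamma_i^2\langle f,f_i\rangle f_i$ is its frame operator; $S_{\mathcal{W}'}f=\sum_{i\in I_2}\pi_{W_i}f$. The inverses $S_{\gamma\mathcal{F}}^{-1}$ and $S_{\mathcal{W}'}^{-1}$ are taken on the closed linear spans of $\{f_i\}_{i\in I_1}$ and of $\{W_i\}_{i\in I_2}$, respectively.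
   Formalization: In (b) the equation U*Uf = S_{γF}^{-1}f is required for f in span{f_i}, the domain of S_{γF}^{-1}, instead of f in span{Uf_i}; as printed it can be undefined, and (ii)⇒(i) fails, e.g. for a bilateral shift U on ℓ²(Z). *)

(* Defs.v *)
From HB Require Import structures.
From mathcomp Require Import all_boot all_order all_algebra.
From mathcomp Require Import sesquilinear complex finmap.
From mathcomp Require Import all_classical all_reals all_analysis.
From mathcomp Require Import summability.

Set Implicit Arguments.
Unset Strict Implicit.
Unset Printing Implicit Defensive.

Import Order.TTheory GRing.Theory Num.Theory.
Import numFieldNormedType.Exports.

Local Open Scope classical_set_scope.
Local Open Scope ring_scope.

(* Real and complex Hilbert spaces are treated at once. *)
Variant scalar_kind := RealScalars | ComplexScalars.

Definition base_field (R : realType) (k : scalar_kind) : numFieldType :=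
  match k with RealScalars => R | ComplexScalars => R[i] end.

Definition base_conj (R : realType) (k : scalar_kind) :
    base_field R k -> base_field R k :=
  match k with RealScalars => idfun | ComplexScalars => @Num.conj R[i] end.

(* Unconditional convergence: the net of the sums over finite index sets. *)
Notation has_sum F s := (partial_sum F @ totally --> s).

Section LinearDimension.
Context {K : numFieldType} {E : lmodType K}.

Definition has_dim (V : set E) (n : nat) : Prop :=
  exists b : 'I_n -> E,
    (forall a : 'I_n -> K, \sum_i a i *: b i = 0 -> forall i, a i = 0) /\
    V = [set v | exists a : 'I_n -> K, v = \sum_i a i *: b i].

End LinearDimension.

Section ClosedSubspaces.
Context {K : numFieldType} {H : normedModType K}.

Definition closed_subspace (M : set H) : Prop :=
  [/\ M 0, (forall u v, M u -> M v -> M (u + v)),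
      (forall (a : K) u, M u -> M (a *: u)) & closed M].

Definition cspan (A : set H) : set H := smallest closed_subspace A.

Definition separable_space : Prop :=
  exists D : set H, countable D /\ dense D.

Definition invertible_op (U : H -> H) : Prop :=
  exists2 T : {linear H -> H}, continuous T & cancel U T /\ cancel T U.

End ClosedSubspaces.
Arguments separable_space {K} H.

(* In [{dot H for cj}] the form is linear in its first argument and
   [cj]-semilinear in the second one. *)
Section Frames.
Context {K : numFieldType} {cj : K -> K} {H : completeNormedModType K}.
Variable ip : {dot H for cj}.

Definition orthogonal_sets (M N : set H) : Prop :=
  forall u v, M u -> N v -> ip u v = 0.

Definition orthogonal_family (J : choiceType) (W : J -> set H) : Prop :=
  forall i j, i != j -> orthogonal_sets (W i) (W j).

Definition orthogonal_direct_sum (M N : set H) : Prop :=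
  orthogonal_sets M N /\
  forall h, exists u v, [/\ M u, N v & h = u + v].

Definition orthproj (W : set H) (f : H) : H :=
  xget 0 [set g | W g /\ forall w, W w -> ip (f - g) w = 0].

Definition adjoint (U : H -> H) (g : H) : H :=
  xget 0 [set h | forall f, ip (U f) g = ip f h].

Section Families.
Context {J : choiceType}.

Definition fusion_frame_bounds (W : J -> set H) (w : J -> K) (A B : K) : Prop :=
  forall f : H, exists s : K,
    has_sum (fun i => w i ^+ 2 * `|orthproj (W i) f| ^+ 2) s /\
    A * `|f| ^+ 2 <= s <= B * `|f| ^+ 2.

Definition weighted_subspaces (W : J -> set H) (w : J -> K) : Prop :=
  (forall i, closed_subspace (W i)) /\ (forall i, 0 < w i).

Definition fusion_frame (W : J -> set H) (w : J -> K) : Prop :=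
  weighted_subspaces W w /\
  exists A B : K, 0 < A /\ A <= B /\ fusion_frame_bounds W w A B.

Definition parseval_fusion_frame (W : J -> set H) (w : J -> K) : Prop :=
  weighted_subspaces W w /\ fusion_frame_bounds W w 1 1.

Definition fusion_synthesis_kernel (W : J -> set H) (w : J -> K) :
    set (J -> H) :=
  [set g | (forall i, W i (g i)) /\
           (exists s : K, has_sum (fun i => `|g i| ^+ 2) s) /\
           has_sum (fun i => w i *: g i) (0 : H)].

Definition fusion_excess (W : J -> set H) (w : J -> K) (n : nat) : Prop :=
  has_dim (fusion_synthesis_kernel W w) n.

Definition fusion_riesz_basis (W : J -> set H) : Prop :=
  [/\ (forall i, closed_subspace (W i)),
      cspan (\bigcup_i W i) = setT
    & exists C D : K, [/\ 0 < C, 0 < D &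
        forall (L : {fset J}) (f : J -> H), (forall j, j \in L -> W j (f j)) ->
          C * (\sum_(j <- L) `|f j| ^+ 2) <= `|\sum_(j <- L) f j| ^+ 2
            <= D * (\sum_(j <- L) `|f j| ^+ 2)]].

Definition frame_sequence (g : J -> H) : Prop :=
  exists A B : K, 0 < A /\ A <= B /\
    forall f, cspan (range g) f -> exists s : K,
      has_sum (fun i => `|ip f (g i)| ^+ 2) s /\
      A * `|f| ^+ 2 <= s <= B * `|f| ^+ 2.

Definition synthesis_kernel (g : J -> H) : set (J -> K^o) :=
  [set c | (exists s : K, has_sum (fun i => `|c i| ^+ 2) s) /\
           has_sum (fun i => c i *: g i) (0 : H)].

Definition excess (g : J -> H) (n : nat) : Prop :=
  has_dim (synthesis_kernel g) n.

Definition strictly_scalable (g : J -> H) (c : J -> K) : Prop :=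
  (forall i, 0 < c i) /\
  forall f, cspan (range g) f ->
    has_sum (fun i => c i ^+ 2 *: (ip f (g i) *: g i)) f.

(* [sum] takes one and the same value at all divergent families. Hence neither
   operator below can be injective on a subspace unless its series converges
   at every point of that subspace: it would agree at [f] and [2 *: f]. *)
Definition frame_operator (g : J -> H) (f : H) : H :=
  sum (fun i => ip f (g i) *: g i).

Definition fusion_frame_operator (W : J -> set H) (w : J -> K) (f : H) : H :=
  sum (fun i => w i ^+ 2 *: orthproj (W i) f).

End Families.

(* [None] is the index 0 of V_0. *)
Definition adjoin_subspace (I : choiceType) (V0 : set H) (W : I -> set H) :
    option I -> set H :=
  fun o => if o is Some i then W i else V0.

Definition fusion_scalable (J : choiceType) (U : H -> H) (V : J -> set H)
    (c : J -> K) : Prop :=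
  parseval_fusion_frame (fun i => U @` V i) c.

End Frames.

(* Main.v *)
Require Import Defs.
From mathcomp Require Import all_boot all_order all_algebra.
From mathcomp Require Import sesquilinear complex finmap.
From mathcomp Require Import all_classical all_reals all_analysis.
From mathcomp Require Import summability ring.

(** Let c be the weights, P_o the orthogonal projection onto U V_o, and write 0
    for the index of the line V_0 spanned by x.

    From scalability to the splitting.  A Parseval fusion frame reconstructs
    every vector, f = sum_o c_o^2 P_o f ([parseval_reconstruction]).  For g in
    W_j, pull the reconstruction of U g back by the inverse of U: its term of
    index 0 is a multiple beta(g) x = beta(g) sum_i x_i of x, and its term of
    index i lies in W_i.  Decompositions along a Riesz basis are unique
    ([riesz_unique]), so that for all i
      c_i^2 U^-1 P_i U g + beta(g) x_i = [i = j] g      ([scalable_components]).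
    When x_j <> 0, the component i = j says that (1 - c_j^2) g is a multiple of
    x_j; moreover c_j^2 <> 1, for otherwise beta would vanish at x_j and U x_j
    would be orthogonal to all the other U x_i, hence |U x_j|^2 = <U x_j, U x>
    = 0.  So W_j is the line of x_j ([scalable_line]).  When x_j = 0, the
    component j of any h in W_i, i <> j, says that U h is orthogonal to U W_j
    ([scalable_orthogonal]).  Hence I_1 = {0} together with the support of
    (x_i), and I_2 = {i : x_i = 0}, give the splitting in the form (a).  The
    generators f_i are normalised by |U f_i| = 1: the one relation
    U x = sum_i U x_i between the lines then has square-summable coefficients,
    and the excess is 1 even when the support of (x_i) is infinite.

    From the splitting to scalability.  Condition (b) yields the strict
    scalability and the orthogonality that (a) asserts.  An injective frame
    operator is given by a convergent series ([sum_converges]); then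
    S U^* U = 1 on the span of the f_i is the reconstruction formula of the
    U f_i carried over by U ([strictly_scalable_of_adjoint]).  And if
    S v = w lies in W_j for S = S_W', then sum_i P_(W_i) v = w, so that
    uniqueness of decompositions makes v orthogonal to the other W_i; with
    v = U^* U g, this is the orthogonality of U W_j to the other U W_i
    ([orthogonal_family_of_adjoint]).  Finally, strict scalability gives the
    Parseval identity on the first summand, the weight gam_i |U f_i| turning
    gam_i^2 <., U f_i> U f_i into a weighted projection, and orthogonality gives
    it with weights 1 on the second; the two add up by Pythagoras
    ([split_scalable]). *)
Import Order.TTheory GRing.Theory Num.Theory.
Import numFieldNormedType.Exports.
Local Open Scope classical_set_scope.
Local Open Scope ring_scope.

Set Implicit Arguments.
Unset Strict Implicit.

(** * Scalars *)

(** What the real and the complex scalars share: all that follows uses a scalar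
    field only through these properties.  Least upper bounds are asked of sets
    of nonnegative scalars, which for the complex field are sets of real
    numbers. *)
Record hilbert_scalars (K : numFieldType) (cj : K -> K) : Prop := HilbertScalars {
  cjK : involutive cj;
  mulr_cj : forall a : K, a * cj a = `|a| ^+ 2;
  cj_ge0 : forall a : K, 0 <= a -> cj a = a;
  nneg_lub : forall A : set K, A !=set0 -> (forall a, A a -> 0 <= a) ->
    (exists B, forall a, A a -> a <= B) ->
    exists s, (forall a, A a -> a <= s) /\
      (forall e, 0 < e -> exists2 a, A a & s - e < a) }.

Lemma realType_lub (R : realType) (A : set R) : A !=set0 ->
  (exists B, forall a, A a -> a <= B) ->
  exists s, (forall a, A a -> a <= s) /\
    (forall e, 0 < e -> exists2 a, A a & s - e < a).
Proof.
move=> A0 [B AB]; have supA : has_sup A by split=> //; exists B => a /AB.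
exists (sup A); split=> [a Aa|e e0]; first by apply: ub_le_sup => //; case: supA.
exact: sup_adherent.
Qed.

Lemma base_field_scalars (R : realType) (k : scalar_kind) :
  hilbert_scalars (@base_conj R k).
Proof.
case: k => /=.
  split=> [//|a|//|A A0 _ Ab]; last exact: realType_lub.
  by rewrite real_normK ?num_real.
split=> [||a a0|A A0 Ap [B AB]]; first exact: conjCK.
- by move=> a; rewrite normCK.
- by apply: conj_Creal; apply: ger0_real.
have ReK (a : R[i]) : 0 <= a -> (complex.Re a)%:C%C = a.
  by move=> a0; rewrite RRe_real // ger0_real.
have [s [As sup_s]] : exists s, (forall a, (@complex.Re R @` A) a -> a <= s) /\
    (forall e, 0 < e -> exists2 a, (@complex.Re R @` A) a & s - e < a).
  apply: realType_lub; first by case: A0 => a Aa; exists (complex.Re a), a.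
  exists (complex.Re B) => _ [a Aa <-].
  by have := AB _ Aa; rewrite lecE => /andP[].
exists s%:C%C; split=> [a Aa|e e0].
  by rewrite -(ReK _ (Ap _ Aa)) lecR; apply: As; exists a.
have [|_ [a Aa <-] sa] := sup_s (complex.Re e).
  by rewrite -ltcR ReK // ltW.
by exists a => //; rewrite -(ReK _ (Ap _ Aa)) -(ReK e) ?ltW // -rmorphB ltcR.
Qed.

(** * Closed subspaces *)

Section ClosedSubspaceTheory.
Context {K : numFieldType} {H : normedModType K}.
Implicit Types (M N A : set H) (u v : H).

(** Closedness as stability under approximation in norm, the form in which
    subspaces given by equations, or as intersections, are shown to be closed. *)
Lemma closed_approxP M :
  closed M <-> (forall u, (forall e, 0 < e -> exists2 v, M v & `|u - v| < e) -> M u).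
Proof.
split=> [clM u Mu|Mapp u clu].
  apply: clM => B /nbhs_ballP[e /= e0 eB].
  have [v Mv uv] := Mu _ e0; exists v; split=> //; apply: eB.
  by rewrite -ball_normE.
apply: Mapp => e e0; have [|v [Mv]] := clu (ball u e).
  exact: nbhsx_ballx.
by rewrite -ball_normE /= => uv; exists v.
Qed.

Lemma cspan_sub A : A `<=` cspan A.
Proof. exact: sub_smallest. Qed.

Lemma cspan_min A M : closed_subspace M -> A `<=` M -> cspan A `<=` M.
Proof. exact: smallest_sub. Qed.

Lemma cspan_closed A : closed_subspace (cspan A).
Proof.
split.
- by move=> M [[M0 _ _ _] _].
- by move=> u v Au Av M [M_ AM]; have [_ + _ _] := M_; apply; [exact: Au|exact: Av].
- by move=> a u Au M [M_ AM]; have [_ _ + _] := M_; apply; exact: Au.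
- apply/closed_approxP => u uA M [M_ AM]; have [_ _ _ /closed_approxP] := M_; apply.
  by move=> e /uA[v Av uv]; exists v => //; apply: Av.
Qed.

Lemma closed_subspaceB M u v : closed_subspace M -> M u -> M v -> M (u - v).
Proof.
by move=> [M0 MD MZ _] Mu Mv; apply: MD => //; rewrite -scaleN1r; apply: MZ.
Qed.

Lemma eq_cspan_setZ (a : K) u : a != 0 -> cspan [set a *: u] = cspan [set u].
Proof.
move=> a0; rewrite eqEsubset; split; apply: cspan_min; try exact: cspan_closed.
  by move=> _ ->; have [_ _ uZ _] := cspan_closed [set u]; apply: uZ; exact: cspan_sub.
move=> _ ->; have [_ _ auZ _] := cspan_closed [set a *: u].
have := auZ a^-1 (a *: u); rewrite scalerK //; apply; exact: cspan_sub.
Qed.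

Lemma cspan0 : cspan [set 0 : H] = [set 0].
Proof.
rewrite eqEsubset; split; last exact: cspan_sub.
apply: cspan_min => //; split=> //.
- by move=> u v -> ->; rewrite /= addr0.
- by move=> a u ->; rewrite /= scaler0.
apply/closed_approxP => u uA; apply/eqP; rewrite -normr_eq0.
apply/negPn/negP => u0; have [|_ -> ] := uA `|u|; first by rewrite lt_def u0 /=.
by rewrite subr0 ltxx.
Qed.

End ClosedSubspaceTheory.

Section BoundedMaps.
Context {K : numFieldType} {H : normedModType K}.

Lemma continuous_linear_bound (U : {linear H -> H}) : continuous U ->
  exists2 M : K, 0 < M & forall u, `|U u| <= M * `|u|.
Proof.
move=> /linear_bounded_continuous/linear_boundedP[N [Nr NU]].
exists (`|N| + 1); first by rewrite ltr_wpDl.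
by apply: NU; rewrite (le_lt_trans (real_ler_norm Nr)) // ltrDl.
Qed.

Lemma closed_subspace_preimage (U : {linear H -> H}) (M : set H) :
  continuous U -> closed_subspace M -> closed_subspace (U @^-1` M).
Proof.
move=> /continuous_linear_bound[B B0 UB] [M0 MD MZ /closed_approxP Mcl]; split.
- by rewrite /preimage /= linear0.
- by move=> u v; rewrite /preimage /= linearD; apply: MD.
- by move=> a u; rewrite /preimage /= linearZ; apply: MZ.
apply/closed_approxP => u uM; apply: Mcl => e e0.
have [|v Mv uv] := uM (e / B); first exact: divr_gt0.
exists (U v) => //; rewrite -linearB (le_lt_trans (UB _)) //.
by rewrite mulrC -ltr_pdivlMr.
Qed.

Lemma cspan_preimage (U : {linear H -> H}) (A B : set H) :
  continuous U -> (forall u, A u -> cspan B (U u)) ->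
  forall u, cspan A u -> cspan B (U u).
Proof.
move=> Uc AB; apply: (@cspan_min _ _ A (U @^-1` cspan B)) => //.
exact/closed_subspace_preimage/cspan_closed.
Qed.

End BoundedMaps.

(** * Unconditional sums *)

Section Sums.
Context {K : numFieldType}.

(** The epsilon form of [has_sum]: it speaks of norms alone, so that it does not
    depend on the path by which a scalar or a vector is seen in a topological
    space. *)
Definition sums_to {V : normedZmodType K} (J : choiceType) (F : J -> V) (s : V) :=
  forall e : K, 0 < e -> exists L0 : {fset J}, forall L : {fset J},
    (L0 `<=` L)%fset -> `|s - \sum_(j <- L) F j| < e.

Lemma has_sumP {V : normedModType K} (J : choiceType) (F : J -> V) (s : V) :
  has_sum F s <-> sums_to F s.
Proof.
have FF := @totally_filter J.
have sumE (L : {fset J}) : partial_sum F L = \sum_(j <- L) F j.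
  by rewrite /partial_sum big_seq_fsetE.
split=> [/cvgrPdist_lt Fs e e0|Fs].
  have [L0 _ L0P] := Fs e e0; exists L0 => L L0L.
  by rewrite -sumE; apply: L0P.
apply/cvgrPdist_lt => e e0; have [L0 L0P] := Fs e e0.
by exists L0 => //= L L0L; rewrite sumE; apply: L0P.
Qed.

Lemma has_sumKP (J : choiceType) (F : J -> K) (s : K) :
  has_sum F s <-> sums_to F s.
Proof. exact: (@has_sumP K^o). Qed.

Section Group.
Context {V : normedZmodType K}.
Variable J : choiceType.
Implicit Types (F G : J -> V) (s t : V).

Lemma eq_sums_to F G s : sums_to F s -> F =1 G -> sums_to G s.
Proof. by move=> Fs /funext<-. Qed.

(** Bounded additive maps commute with unconditional sums.  Scaling, bounded
    operators and the inner product with a fixed vector are all of this kind. *)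
Lemma sums_to_addmap {V' : normedZmodType K} (phi : V -> V') (M : K) F s :
  0 <= M -> {morph phi : u v / u + v} -> (forall u, `|phi u| <= M * `|u|) ->
  sums_to F s -> sums_to (fun j => phi (F j)) (phi s).
Proof.
move=> M0 phiD phiM Fs e e0.
have phi0 : phi 0 = 0 by apply: (addrI (phi 0)); rewrite -phiD !addr0.
have phiN u : phi (- u) = - phi u.
  by apply: (addrI (phi u)); rewrite -phiD !subrr.
have M1 : 0 < M + 1 by rewrite ltr_wpDl.
have [|L0 L0P] := Fs (e / (M + 1)); first exact: divr_gt0.
exists L0 => L /L0P; rewrite ltr_pdivlMr // mulrC => /(le_lt_trans _); apply.
rewrite -(big_morph phi phiD phi0) -phiN -phiD (le_trans (phiM _)) //.
by rewrite ler_wpM2r // lerDl.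
Qed.

Lemma sums_toN F s : sums_to F s -> sums_to (fun j => - F j) (- s).
Proof.
apply: (@sums_to_addmap _ -%R 1) => // [u v|u]; first by rewrite opprD.
by rewrite normrN mul1r.
Qed.

Lemma sums_toD F G s t :
  sums_to F s -> sums_to G t -> sums_to (fun j => F j + G j) (s + t).
Proof.
move=> Fs Gt e e0; have e20 : 0 < e / 2 by rewrite divr_gt0.
have [[A AP] [B BP]] := (Fs _ e20, Gt _ e20).
exists (A `|` B)%fset => L; rewrite fsubUset => /andP[AL BL].
rewrite big_split /= opprD addrACA (le_lt_trans (ler_normD _ _)) //.
by rewrite [e]splitr ltrD ?AP ?BP.
Qed.

Lemma sums_toB F G s t :
  sums_to F s -> sums_to G t -> sums_to (fun j => F j - G j) (s - t).
Proof. by move=> Fs /sums_toN; apply: sums_toD. Qed.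

Lemma sums_to_eq0 s : sums_to (fun _ : J => 0 : V) s -> s = 0.
Proof.
move=> Fs; apply/eqP; rewrite -normr_eq0; apply/negPn/negP => s0.
have [|L0 /(_ L0 (fsubset_refl _))] := Fs `|s|; first by rewrite lt_def s0 /=.
by rewrite big1 // subr0 ltxx.
Qed.

Lemma sums_to_unique F s t : sums_to F s -> sums_to F t -> s = t.
Proof.
move=> Fs Ft; apply/eqP; rewrite -subr_eq0; apply/eqP/sums_to_eq0.
by apply: eq_sums_to (sums_toB Fs Ft) _ => j; rewrite subrr.
Qed.

Lemma sums_to_delta (j0 : J) (v : V) :
  sums_to (fun j => if j == j0 then v else 0) v.
Proof.
move=> e e0; exists [fset j0]%fset => L; rewrite fsub1set => Lj0.
rewrite (big_fsetD1 j0) //= eqxx big1_fset ?addr0 ?subrr ?normr0 // => j.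
by rewrite !inE => /andP[/negPf->].
Qed.

End Group.

Section Reindexing.
Context {V : normedZmodType K}.

Lemma fset_preimage (J' J : choiceType) (h : J' -> J) (L : {fset J}) :
  injective h -> exists L' : {fset J'}, forall j', (j' \in L') = (h j' \in L).
Proof.
move=> h_inj.
pose g j : option J' := if pselect (exists j', h j' = j) is left e
                        then Some (sval (cid e)) else None.
have gh j' : g (h j') = Some j'.
  rewrite /g; case: pselect => [e|[]]; last by exists j'.
  by congr Some; apply: h_inj; case: cid.
exists [fset j' in pmap g L]%fset => j'; rewrite !inE mem_pmap.
apply/mapP/idP => [[j Lj]|Lj]; last by exists (h j').
rewrite /g; case: pselect => // e [->]; case: cid => i /= hi.
by rewrite hi.
Qed.

(** A finite set of indices in J contributes only through its part in the range
    of h, and the finite sets of indices in J' are exactly these parts. *)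
Lemma sums_to_inj (J' J : choiceType) (h : J' -> J) (F : J -> V) (s : V) :
  injective h -> (forall j, (forall j', h j' <> j) -> F j = 0) ->
  sums_to (F \o h) s <-> sums_to F s.
Proof.
move=> h_inj F0.
have sumh (L : {fset J}) (L' : {fset J'}) :
    (forall j', (j' \in L') = (h j' \in L)) ->
    \sum_(j <- L) F j = \sum_(j' <- L') F (h j').
  move=> L'L; rewrite -[RHS](big_map h xpredT F).
  rewrite (bigID (mem (map h L'))) /= [X in _ + X]big_seq_cond.
  rewrite [X in _ + X]big1 ?addr0 => [|j /andP[Lj jL']]; last first.
    apply: F0 => j' hj'; move/negP: jL'; apply; apply/mapP; exists j' => //.
    by rewrite L'L hj'.
  rewrite -big_filter; apply: perm_big; apply: uniq_perm.
  - by rewrite filter_uniq ?fset_uniq.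
  - by rewrite map_inj_uniq ?fset_uniq.
  move=> j; rewrite mem_filter andb_idr // => /mapP[j' + ->].
  by rewrite L'L.
split=> Fs e e0; have [L0 L0P] := Fs e e0.
  exists (h @` L0)%fset => L /fsubsetP hL.
  have [L' L'L] := fset_preimage L h_inj.
  rewrite (sumh _ _ L'L); apply: L0P; apply/fsubsetP => j' L0j'.
  by rewrite L'L; apply: hL; apply/imfsetP; exists j'.
have [L0' L0'L] := fset_preimage L0 h_inj.
exists L0' => L' /fsubsetP L0L'.
rewrite -(sumh (L0 `|` h @` L')%fset L').
  by apply: L0P; apply: fsubsetUl.
move=> j'; rewrite inE; apply/idP/orP => [Lj'|[]].
- by right; apply/imfsetP; exists j'.
- by rewrite -L0'L; apply: L0L'.
by move=> /imfsetP[i /= iL /h_inj->].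
Qed.

Lemma sums_to_val (J : choiceType) (A : set J) (F : J -> V) (s : V) :
  (forall j, ~ A j -> F j = 0) ->
  sums_to (fun i : A => F (val i)) s <-> sums_to F s.
Proof.
move=> F0; apply: (@sums_to_inj _ _ val); first exact: val_inj.
move=> j nj; apply: F0 => Aj; apply: (nj (SigSub (mem_set Aj))).
exact: SubK.
Qed.

Definition extend0 (J : choiceType) (A : set J) (a : A -> V) (j : J) : V :=
  if pselect (A j) is left Aj then a (SigSub (mem_set Aj)) else 0.

Lemma extend0_val (J : choiceType) (A : set J) (a : A -> V) (i : A) :
  extend0 a (val i) = a i.
Proof.
rewrite /extend0; case: pselect => [Ai|[]]; last exact: set_mem (valP i).
by congr a; apply: val_inj; rewrite SubK.
Qed.

Lemma extend0_out (J : choiceType) (A : set J) (a : A -> V) j :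
  ~ A j -> extend0 a j = 0.
Proof. by rewrite /extend0; case: pselect. Qed.

Lemma sums_to_extend0 (J : choiceType) (A : set J) (a : A -> V) s :
  sums_to a s <-> sums_to (extend0 a) s.
Proof.
rewrite -(sums_to_val s (@extend0_out _ _ a)).
by split=> /eq_sums_to; apply => i; rewrite extend0_val.
Qed.

Lemma sums_to_option (I : choiceType) (F : option I -> V) (s : V) :
  sums_to F s <-> sums_to (fun i => F (Some i)) (s - F None).
Proof.
have inj : injective (@Some I) by move=> i j [].
pose G o := if o is Some i then F o else 0.
have G0 o : (forall i, Some i <> o) -> G o = 0 by case: o => //= i /(_ i).
have FG o : F o = G o + (if o == None then F None else 0).
  by case: o => [i|]; rewrite /= ?addr0 ?add0r.
have FN := sums_to_delta (None : option I) (F None).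
have [G1 G2] := sums_to_inj (s - F None) inj G0.
split=> [Fs|Fs].
  apply: G2; apply: eq_sums_to (sums_toB Fs FN) _ => o.
  by rewrite FG addrK.
rewrite -(subrK (F None) s).
by apply: eq_sums_to (sums_toD (G1 Fs) FN) _ => o; rewrite -FG.
Qed.

End Reindexing.

Lemma sums_toZ {V : normedModType K} (J : choiceType) (a : K) (F : J -> V) (s : V) :
  sums_to F s -> sums_to (fun j => a *: F j) (a *: s).
Proof.
apply: (@sums_to_addmap _ _ _ ( *:%R a) `|a|) => // [u v|u]; first by rewrite scalerDr.
by rewrite normrZ.
Qed.

End Sums.

Section NonnegativeSums.
Context {K : numFieldType} {cj : K -> K} (Ks : hilbert_scalars cj).
Variables (J : choiceType) (F : J -> K).
Hypothesis F_ge0 : forall j, 0 <= F j.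

Lemma sum_ge0 (L : {fset J}) : 0 <= \sum_(j <- L) F j.
Proof. by apply: sumr_ge0. Qed.

Lemma nneg_sum_mono (L L' : {fset J}) :
  (L `<=` L')%fset -> \sum_(j <- L) F j <= \sum_(j <- L') F j.
Proof.
move=> LL'; rewrite [leRHS](big_fsetID _ (mem L)) /=.
have -> : [fset x | x in L' & x \in L]%fset = L.
  by apply/fsetP => j; rewrite !inE /= andb_idl //; apply/fsubsetP.
by rewrite lerDl sumr_ge0.
Qed.

(** The limit is the supremum of the finite sums, a monotone net. *)
Lemma nneg_sums_to_bounded (B : K) : (forall L : {fset J}, \sum_(j <- L) F j <= B) ->
  exists s, [/\ sums_to F s, (forall L : {fset J}, \sum_(j <- L) F j <= s) & s <= B].
Proof.
move=> FB; pose A := [set \sum_(j <- L) F j | L in @setT {fset J}].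
have [||| s [As sup_s]] := nneg_lub Ks (A := A).
- by exists (\sum_(j <- fset0) F j), fset0.
- by move=> _ [L _ <-]; exact: sum_ge0.
- by exists B => _ [L _ <-].
have Fs (L : {fset J}) : \sum_(j <- L) F j <= s by apply: As; exists L.
have s0 : 0 <= s by apply: (le_trans _ (Fs fset0)); apply: sum_ge0.
have B0 : 0 <= B by apply: (le_trans _ (FB fset0)); apply: sum_ge0.
exists s; split => //.
  move=> e e0; have [_ [L _ <-] sL] := sup_s _ e0.
  exists L => L' /nneg_sum_mono LL'; rewrite ger0_norm ?subr_ge0 //.
  by rewrite ltrBlDr -ltrBlDl (lt_le_trans sL).
rewrite real_leNgt ?ger0_real //; apply/negP => Bs.
have [|_ [L _ <-]] := sup_s (s - B); first by rewrite subr_gt0.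
by rewrite opprB addrC subrK => /lt_le_trans/(_ (FB L)); rewrite ltxx.
Qed.

(** The sum s is not known to be real; it is so by comparison with the supremum
    of the finite sums, which are bounded because they are eventually within 1
    of s. *)
Lemma nneg_sums_to_ge (s : K) (L : {fset J}) : sums_to F s -> \sum_(j <- L) F j <= s.
Proof.
move=> Fs; have [L0 L0P] := Fs 1 ltr01.
have [L1|t [Ft + _]] := nneg_sums_to_bounded (B := `|s| + 1).
  apply: (le_trans (nneg_sum_mono (fsubsetUr L0 L1))).
  rewrite -[leLHS]ger0_norm ?sum_ge0 // -lerBlDl (le_trans (lerB_dist _ _)) //.
  by rewrite distrC ltW // L0P // fsubsetUl.
by rewrite (sums_to_unique Fs Ft).
Qed.

Lemma nneg_sums_to_le (s B : K) :
  (forall L : {fset J}, \sum_(j <- L) F j <= B) -> sums_to F s -> s <= B.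
Proof.
by move=> /nneg_sums_to_bounded[t [Ft _ tB]] /sums_to_unique/(_ Ft)->.
Qed.

End NonnegativeSums.

(** * Hilbert space geometry *)

Section Hilbert.
Context {K : numFieldType} {cj : K -> K} (Ks : hilbert_scalars cj).
Context {H : completeNormedModType K} (ip : {dot H for cj}).
Hypothesis ip_norm : forall u : H, ip u u = `|u| ^+ 2.
Implicit Types (M N : set H) (f g h u v w : H) (a : K).

Lemma ipC u v : ip u v = cj (ip v u).
Proof. by rewrite [LHS]hermitian_subproof expr0 mul1r. Qed.

Lemma ip_eq0C u v : ip u v = 0 -> ip v u = 0.
Proof. by rewrite ipC => /(congr1 cj); rewrite (cjK Ks) (cj_ge0 Ks). Qed.

Lemma ipDl u v w : ip (u + v) w = ip u w + ip v w. Proof. exact: linearDl. Qed.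
Lemma ipDr u v w : ip u (v + w) = ip u v + ip u w. Proof. exact: linearDr. Qed.
Lemma ipBl u v w : ip (u - v) w = ip u w - ip v w. Proof. exact: linearBl. Qed.
Lemma ipBr u v w : ip u (v - w) = ip u v - ip u w. Proof. exact: linearBr. Qed.
Lemma ip0l u : ip 0 u = 0. Proof. exact: linear0l. Qed.
Lemma ip0r u : ip u 0 = 0. Proof. exact: linear0r. Qed.
Lemma ipZl a u v : ip (a *: u) v = a * ip u v. Proof. exact: linearZl_LR. Qed.
Lemma ipZr a u v : ip u (a *: v) = cj a * ip u v. Proof. exact: linearZr_LR. Qed.

Lemma ip_self_eq0 u : ip u u = 0 -> u = 0.
Proof. by rewrite ip_norm => /eqP; rewrite expf_eq0 /= normr_eq0 => /eqP. Qed.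

Lemma pythagoras u v : ip u v = 0 -> `|u + v| ^+ 2 = `|u| ^+ 2 + `|v| ^+ 2.
Proof.
by move=> uv; rewrite -!ip_norm ipDl !ipDr uv (ip_eq0C uv) addr0 add0r.
Qed.

Lemma parallelogram u v :
  `|u + v| ^+ 2 + `|u - v| ^+ 2 = (`|u| ^+ 2 + `|v| ^+ 2) *+ 2.
Proof.
have -> : `|u + v| ^+ 2 = ip u u + ip u v + (ip v u + ip v v).
  by rewrite -ip_norm ipDl !ipDr.
have -> : `|u - v| ^+ 2 = ip u u - ip u v - (ip v u - ip v v).
  by rewrite -ip_norm ipBl !ipBr.
by rewrite -!ip_norm; ring.
Qed.

(** Pythagoras for the component of f along v.  It yields the Cauchy-Schwarz
    inequality, and orthogonality to v of a nearest point in a subspace. *)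
Lemma norm_residue_line f v : v != 0 ->
  `|f - (ip f v / `|v| ^+ 2) *: v| ^+ 2 = `|f| ^+ 2 - `|ip f v| ^+ 2 / `|v| ^+ 2.
Proof.
move=> v0; have v20 : `|v| ^+ 2 != 0 by rewrite expf_eq0 normr_eq0.
set c := _ / _; have fcv : ip (f - c *: v) v = 0.
  by rewrite ipBl ipZl ip_norm /c divfK // subrr.
rewrite -ip_norm ipBr ipZr fcv mulr0 subr0 ipBl ipZl ip_norm /c.
by rewrite [ip v f]ipC mulrAC (mulr_cj Ks).
Qed.

Lemma cauchy_schwarz u v : `|ip u v| <= `|u| * `|v|.
Proof.
have [->|v0] := eqVneq v 0; first by rewrite ip0r !normr0 mulr0.
have v20 : 0 < `|v| ^+ 2 by rewrite exprn_gt0 // normr_gt0.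
rewrite -(ler_pXn2r (n := 2)) ?nnegrE ?mulr_ge0 // exprMn.
rewrite -ler_pdivrMr // -subr_ge0 -norm_residue_line // exprn_ge0.
Qed.

Lemma sums_to_ipl (J : choiceType) (F : J -> H) s w :
  sums_to F s -> sums_to (fun j => ip (F j) w) (ip s w).
Proof.
apply: (@sums_to_addmap _ _ _ _ (fun u => ip u w) `|w|) => // [u v|u].
  exact: ipDl.
by rewrite mulrC cauchy_schwarz.
Qed.

Lemma sums_to_linear (U : {linear H -> H}) (J : choiceType) (F : J -> H) s :
  continuous U -> sums_to F s -> sums_to (fun j => U (F j)) (U s).
Proof.
move=> /continuous_linear_bound[B B0 UB].
by apply: (@sums_to_addmap _ _ _ _ U B) => //; [exact: ltW|exact: linearD].
Qed.

Lemma orthogonal_closed_subspace (A : set H) :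
  closed_subspace [set u | forall v, A v -> ip u v = 0].
Proof.
split=> /=.
- by move=> v _; rewrite ip0l.
- by move=> u w uA wA v Av; rewrite ipDl uA // wA // addr0.
- by move=> a u uA v Av; rewrite ipZl uA // mulr0.
apply/closed_approxP => u uA v Av; apply/eqP; rewrite -normr_eq0.
apply/negPn/negP => uv0; have uv : 0 < `|ip u v| by rewrite lt_def uv0 /=.
have v1 : 0 < `|v| + 1 by rewrite ltr_wpDl.
have [|w wA] := uA (`|ip u v| / (`|v| + 1)); first exact: divr_gt0.
rewrite ltr_pdivlMr //; have -> : ip u v = ip (u - w) v by rewrite ipBl wA // subr0.
move=> /lt_le_trans/(_ (cauchy_schwarz _ _)).
have : `|u - w| * `|v| <= `|u - w| * (`|v| + 1) by rewrite ler_wpM2l // lerDl.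
by move=> /le_lt_trans h /h; rewrite ltxx.
Qed.

Lemma orthogonal_cspan (A B : set H) : orthogonal_sets ip A B ->
  orthogonal_sets ip (cspan A) (cspan B).
Proof.
move=> AB.
have AcB u v : A u -> cspan B v -> ip u v = 0.
  move=> Au Bv; apply: ip_eq0C; have := Bv.
  move/(cspan_min (orthogonal_closed_subspace [set u])); apply => // w Bw _ ->.
  exact/ip_eq0C/AB.
move=> u v + Bv.
move/(cspan_min (orthogonal_closed_subspace [set v])); apply => // w Aw _ ->.
exact: AcB.
Qed.

(** By the parallelogram law the near minimisers of the distance to f in M form
    a Cauchy filter; its limit lies in M, and the residue at the limit is
    orthogonal to M because the residues at near minimisers are almost so. *)
Theorem projection_theorem M f : closed_subspace M ->
  exists g, M g /\ forall w, M w -> ip (f - g) w = 0.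
Proof.
move=> Mcl; have [M0 MD MZ /closed_approxP Mapp] := Mcl.
(* s is the infimum of |f - w|^2 over M, as the supremum of its lower bounds *)
have [||| s [As sup_s]] := nneg_lub Ks
  (A := [set a | 0 <= a /\ forall w, M w -> a <= `|f - w| ^+ 2]).
- by exists 0; split=> // w _; rewrite exprn_ge0.
- by move=> a [].
- by exists (`|f - 0| ^+ 2) => a [_]; apply.
have s0 : 0 <= s by apply: As; split=> // w _; rewrite exprn_ge0.
have leNgt (a b : K) : 0 <= a -> 0 <= b -> ~ (b < a) -> a <= b.
  by move=> a0 b0 /negP ba; rewrite real_leNgt ?ger0_real.
have s_le w : M w -> s <= `|f - w| ^+ 2.
  move=> Mw; apply: leNgt => // ws.
  have [|a [_ /(_ w Mw) aw]] := sup_s (s - `|f - w| ^+ 2); first by rewrite subr_gt0.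
  by rewrite opprB addrC subrK => /lt_le_trans/(_ aw); rewrite ltxx.
pose S (e : K) := [set w | M w /\ `|f - w| ^+ 2 < s + e].
have S_neq0 e : 0 < e -> exists w, S e w.
  move=> e0; apply: contrapT => Se.
  have : s + e <= s.
    apply: As; split=> [|w Mw]; first by rewrite addr_ge0 // ltW.
    apply: leNgt; rewrite ?addr_ge0 ?(ltW e0) // => we.
    by apply: Se; exists w.
  by rewrite gerDl => /(lt_le_trans e0); rewrite ltxx.
have S_diam e w w' : S e w -> S e w' -> `|w - w'| ^+ 2 < e *+ 4.
  move=> [Mw fw] [Mw' fw'].
  have := s_le _ (MZ 2^-1 _ (MD _ _ Mw Mw')).
  have := parallelogram (f - w) (f - w').
  have -> : f - w - (f - w') = w' - w by rewrite opprB addrC addrA addrNK.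
  have -> : f - w + (f - w') = 2 *: (f - 2^-1 *: (w + w')).
    rewrite scalerBr scalerA divff // scale1r scaler_nat mulr2n.
    by rewrite addrACA opprD.
  rewrite normrZ ger0_norm // exprMn (distrC w' w) => par sw.
  have -> : `|w - w'| ^+ 2 = (`|f - w| ^+ 2 + `|f - w'| ^+ 2) *+ 2
      - 2 ^+ 2 * `|f - 2^-1 *: (w + w')| ^+ 2 by rewrite -par; ring.
  apply: (@lt_le_trans _ _ ((s + e + (s + e)) *+ 2 - 2 ^+ 2 * s)).
    apply: ltr_leB; last by rewrite ler_wpM2l.
    by rewrite ltrMn2r /= ltrD.
  rewrite (_ : _ - _ = e *+ 4) //; ring.
have S_mono d e : d <= e -> S d `<=` S e.
  by move=> de w [Mw fw]; split=> //; apply: lt_le_trans fw _; rewrite lerD2l.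
pose G := filter_from [set e : K | 0 < e] S.
have GF : ProperFilter G.
  apply: filter_from_proper => [|e e0]; last exact: S_neq0.
  apply: filter_from_filter; first by exists 1; rewrite /= ltr01.
  move=> d e /= d0 e0.
  have [de|/ltW ed] := real_leP (gtr0_real d0) (gtr0_real e0).
    by exists d => // w dw; split=> //; apply: S_mono dw.
  by exists e => // w ew; split=> //; apply: S_mono ew.
have : cvg G.
  apply: cauchy_cvg; apply: cauchy_exP => e e0.
  have e40 : 0 < e ^+ 2 / 4 by rewrite divr_gt0 ?exprn_gt0.
  have [w Sw] := S_neq0 _ e40; exists w, (e ^+ 2 / 4) => // w' Sw'.
  rewrite -ball_normE /= -(ltr_pXn2r (n := 2)) ?nnegrE ?(ltW e0) //.
  by have := S_diam _ _ _ Sw Sw'; rewrite -[_ / 4 *+ 4]mulr_natr divfK ?pnatr_eq0.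
move=> /cvg_ex[g /= Gg].
have gapp d e : 0 < d -> 0 < e -> exists2 w, S d w & `|g - w| < e.
  move=> d0 e0.
  have GB : G (ball g e) by apply: Gg; exact: nbhsx_ballx.
  have GS : G (S d) by exists d.
  have [w [Bw Sw]] := filter_ex (filterI GB GS).
  by exists w => //; move: Bw; rewrite -ball_normE.
exists g; split=> [|v Mv].
  by apply: Mapp => e e0; have [w [Mw _] gw] := gapp 1 _ ltr01 e0; exists w.
have [->|v0] := eqVneq v 0; first by rewrite ip0r.
have vn : 0 < `|v| by rewrite normr_gt0.
(* a near minimiser w is nearly orthogonal to v, else w plus the component of
   f - w along v would be nearer to f than the infimum allows *)
have S_orth d w : S d w -> `|ip (f - w) v| ^+ 2 < d * `|v| ^+ 2.
  move=> [Mw fw]; rewrite -ltr_pdivrMr ?exprn_gt0 //.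
  have := s_le _ (MD _ _ Mw (MZ (ip (f - w) v / `|v| ^+ 2) _ Mv)).
  rewrite opprD addrA norm_residue_line // lerBrDr => h.
  by rewrite -(ltrD2l s) (le_lt_trans h).
apply/eqP; rewrite -normr_eq0; apply/negPn/negP => fg0.
have fg : 0 < `|ip (f - g) v| by rewrite lt_def fg0 /=.
set d := `|ip (f - g) v| in fg.
have [||w Sw gw] := gapp ((d / 2 / `|v|) ^+ 2) (d / 2 / `|v|).
- by rewrite exprn_gt0 // !divr_gt0.
- by rewrite !divr_gt0.
have : d <= `|ip (f - w) v| + `|ip (w - g) v|.
  by rewrite /d -[f - g](subrKA w) [ip (_ + (w - g)) v]ipDl ler_normD.
have fw : `|ip (f - w) v| < d / 2.
  rewrite -(ltr_pXn2r (n := 2)) ?nnegrE ?divr_ge0 ?(ltW fg) //.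
  by have := S_orth _ _ Sw; rewrite -exprMn divfK // gt_eqF.
have wg : `|ip (w - g) v| < d / 2.
  apply: le_lt_trans (cauchy_schwarz _ _) _.
  by rewrite -ltr_pdivlMr // distrC.
by move=> /le_lt_trans/(_ (ltrD fw wg)); rewrite -splitr ltxx.
Qed.

Section Projection.
Variables (M : set H) (M_closed : closed_subspace M).
Local Notation P := (orthproj ip M).

Lemma orthproj_spec f : M (P f) /\ forall w, M w -> ip (f - P f) w = 0.
Proof. by have /(xgetPex 0) := projection_theorem f M_closed. Qed.

Lemma orthproj_in f : M (P f). Proof. by case: (orthproj_spec f). Qed.

Lemma orthproj_residue f w : M w -> ip (f - P f) w = 0.
Proof. by move=> Mw; case: (orthproj_spec f) => _; apply. Qed.

Lemma orthproj_unique f g : M g -> (forall w, M w -> ip (f - g) w = 0) -> P f = g.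
Proof.
move=> Mg fg; have MPg := closed_subspaceB M_closed (orthproj_in f) Mg.
apply/eqP; rewrite -subr_eq0; apply/eqP/ip_self_eq0.
set v := P f - g in MPg *.
have {1}-> : v = (f - g) - (f - P f) by rewrite opprB addrC addrA addrNK.
by rewrite ipBl fg // orthproj_residue // subrr.
Qed.

Lemma ip_orthprojl f w : M w -> ip (P f) w = ip f w.
Proof. by move=> /(orthproj_residue f)/eqP; rewrite ipBl subr_eq0 => /eqP. Qed.

Lemma orthproj_selfadjoint f g : ip (P f) g = ip f (P g).
Proof.
rewrite -(ip_orthprojl f (orthproj_in g)); apply/eqP; rewrite -subr_eq0 -ipBr.
by apply/eqP/ip_eq0C/orthproj_residue/orthproj_in.
Qed.

Lemma ip_orthproj_self f : ip (P f) f = `|P f| ^+ 2.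
Proof. by rewrite -ip_norm [RHS]ip_orthprojl ?orthproj_selfadjoint //; exact: orthproj_in. Qed.

Lemma orthprojD : {morph P : f g / f + g}.
Proof.
have [_ MD _ _] := M_closed.
move=> f g; apply: orthproj_unique => [|w Mw].
  by apply: MD; apply: orthproj_in.
by rewrite opprD addrACA ipDl !orthproj_residue // addr0.
Qed.

Lemma orthprojZ a f : P (a *: f) = a *: P f.
Proof.
have [_ _ MZ _] := M_closed.
apply: orthproj_unique => [|w Mw]; first by apply: MZ; apply: orthproj_in.
by rewrite -scalerBr ipZl orthproj_residue // mulr0.
Qed.

Lemma orthproj_id f : M f -> P f = f.
Proof. by move=> Mf; apply: orthproj_unique => // w _; rewrite subrr ip0l. Qed.

Lemma orthproj_eq0 f : (forall w, M w -> ip f w = 0) -> P f = 0.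
Proof.
have [M0 _ _ _] := M_closed.
by move=> fM; apply: orthproj_unique => // w Mw; rewrite subr0 fM.
Qed.

Lemma orthproj_eq0_ip f w : P f = 0 -> M w -> ip f w = 0.
Proof. by move=> Pf0 /ip_orthprojl<-; rewrite Pf0 ip0l. Qed.

End Projection.

Lemma cspan1E g : cspan [set g] = [set a *: g | a in setT].
Proof.
have [->|g0] := eqVneq g 0.
  rewrite cspan0 eqEsubset; split=> [u ->|_ [a _ <-]]; last by rewrite scaler0.
  by exists 0 => //; rewrite scaler0.
have g20 : `|g| ^+ 2 != 0 by rewrite expf_eq0 normr_eq0.
rewrite eqEsubset; split; last first.
  move=> _ [a _ <-]; have [_ _ + _] := cspan_closed [set g]; apply.
  exact: cspan_sub.
(* the line is the orthogonal complement of its own orthogonal complement *)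
pose L := [set u | forall v, ip g v = 0 -> ip u v = 0].
have Lcl : closed_subspace L := orthogonal_closed_subspace [set v | ip g v = 0].
move=> u /(cspan_min Lcl) uL.
have {uL} uL : L u by apply: uL => v ->.
exists (ip u g / `|g| ^+ 2) => //; apply/esym/eqP; rewrite -subr_eq0.
set v := u - _; have gv : ip g v = 0.
  by apply: ip_eq0C; rewrite ipBl ipZl ip_norm divfK // subrr.
apply/eqP/ip_self_eq0; rewrite {1}/v ipBl ipZl gv mulr0 subr0.
exact: uL.
Qed.

Lemma image_cspan1 (U : {linear H -> H}) u :
  U @` cspan [set u] = cspan [set U u].
Proof.
rewrite !cspan1E eqEsubset; split=> [_ [_ [a _ <-] <-]|_ [a _ <-]].
  by exists a => //; rewrite linearZ.
by exists (a *: u); [exists a|rewrite linearZ].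
Qed.

Lemma orthproj_line g f : g != 0 ->
  orthproj ip (cspan [set g]) f = (ip f g / `|g| ^+ 2) *: g.
Proof.
move=> g0; have g20 : `|g| ^+ 2 != 0 by rewrite expf_eq0 normr_eq0.
apply: orthproj_unique; first exact: cspan_closed.
  by rewrite cspan1E; exists (ip f g / `|g| ^+ 2).
rewrite cspan1E => _ [a _ <-].
by rewrite ipZr ipBl ipZl ip_norm divfK // subrr mulr0.
Qed.

(** phi is represented by a multiple of a vector z orthogonal to its kernel:
    f - (phi f / phi z) z lies in the kernel, whatever f. *)
Theorem riesz_representation (phi : H -> K) (B : K) :
  (forall u v, phi (u + v) = phi u + phi v) ->
  (forall a u, phi (a *: u) = a * phi u) ->
  0 < B -> (forall u, `|phi u| <= B * `|u|) ->
  exists h, forall f, phi f = ip f h.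
Proof.
move=> phiD phiZ B0 phiB.
have phi0 : phi 0 = 0 by rewrite -(scale0r 0) phiZ mul0r.
have phiBr u v : phi (u - v) = phi u - phi v by rewrite phiD -scaleN1r phiZ mulN1r.
have Kcl : closed_subspace [set u | phi u = 0].
  split=> //= [u v u0 v0|a u u0|]; rewrite ?phiD ?phiZ ?u0 ?v0 ?addr0 ?mulr0 //.
  apply/closed_approxP => u uK; apply/eqP; rewrite -normr_eq0.
  apply/negPn/negP => u0; have un : 0 < `|phi u| by rewrite lt_def u0 /=.
  have [|v v0] := uK (`|phi u| / B); first exact: divr_gt0.
  rewrite ltr_pdivlMr // mulrC => /(le_lt_trans (phiB _)).
  by rewrite phiBr v0 subr0 ltxx.
have [phi_eq0|] := pselect (forall u, phi u = 0).
  by exists 0 => f; rewrite ip0r.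
move=> /existsNP[f0 phif0].
pose z := f0 - orthproj ip [set u | phi u = 0] f0.
have phiz : phi z = phi f0.
  by rewrite phiBr (_ : phi (orthproj _ _ _) = 0) ?subr0 //; apply: (orthproj_in Kcl).
have z0 : z != 0 by apply/eqP => z0; apply: phif0; rewrite -phiz z0.
have z20 : `|z| ^+ 2 != 0 by rewrite expf_eq0 normr_eq0.
have pz0 : phi z != 0 by rewrite phiz; apply/eqP.
exists (cj (phi z / `|z| ^+ 2) *: z) => f.
have : ip (f - (phi f / phi z) *: z) z = 0.
  apply/ip_eq0C/(orthproj_residue Kcl) => /=.
  by rewrite phiBr phiZ divfK // subrr.
move/eqP; rewrite ipBl ipZl subr_eq0 ip_norm => /eqP fz.
rewrite ipZr (cjK Ks) fz; field.
by rewrite pz0 normr_eq0 z0.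
Qed.

Lemma adjointP (U : {linear H -> H}) f g : continuous U ->
  ip (U f) g = ip f (adjoint ip U g).
Proof.
move=> /continuous_linear_bound[B B0 UB].
have [||||h hP] := @riesz_representation (fun f => ip (U f) g) (B * `|g| + 1).
- by move=> u v; rewrite linearD ipDl.
- by move=> a u; rewrite linearZ ipZl.
- by rewrite ltr_wpDl // mulr_ge0 // ltW.
- move=> u; apply: le_trans (cauchy_schwarz _ _) _.
  apply: (@le_trans _ _ (B * `|u| * `|g|)); first by rewrite ler_wpM2r.
  by rewrite mulrAC ler_wpM2r // lerDl.
have := xgetPex 0 (P := [set h | forall f, ip (U f) g = ip f h]).
by move=> /(_ (ex_intro _ h hP))/(_ f).
Qed.

End Hilbert.

(** * Parseval fusion frames *)

Section ParsevalFusionFrames.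
Context {K : numFieldType} {cj : K -> K} (Ks : hilbert_scalars cj).
Context {H : completeNormedModType K} (ip : {dot H for cj}).
Hypothesis ip_norm : forall u : H, ip u u = `|u| ^+ 2.
Variables (J : choiceType) (Y : J -> set H) (c : J -> K).
Hypothesis Y_closed : forall j, closed_subspace (Y j).
Hypothesis c_gt0 : forall j, 0 < c j.
Local Notation P j := (orthproj ip (Y j)).

Let term_ge0 f j : 0 <= c j ^+ 2 * `|P j f| ^+ 2.
Proof. by rewrite mulr_ge0 // exprn_ge0 // ltW. Qed.

Lemma parseval_weight_le1 j f : Y j f -> f != 0 ->
  sums_to (fun i => c i ^+ 2 * `|P i f| ^+ 2) (`|f| ^+ 2) -> c j ^+ 2 <= 1.
Proof.
move=> Yf f0 /(nneg_sums_to_ge Ks (term_ge0 f) [fset j]%fset).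
rewrite big_seq_fset1 (orthproj_id Ks ip_norm) //.
by rewrite -[leRHS]mul1r ler_pM2r // exprn_gt0 // normr_gt0.
Qed.

(** The residue A f = f - sum_(j in L) c_j^2 P_j f satisfies
    |A f|^2 <= <A f, f> = |f|^2 - sum_(j in L) c_j^2 |P_j f|^2, and the right
    side tends to 0 by the Parseval identity. *)
Lemma parseval_reconstruction :
  (forall f, sums_to (fun j => c j ^+ 2 * `|P j f| ^+ 2) (`|f| ^+ 2)) ->
  forall f, sums_to (fun j => c j ^+ 2 *: P j f) f.
Proof.
move=> Pars f e e0.
have [|L0 L0P] := Pars f (e ^+ 2); first exact: exprn_gt0.
exists L0 => L /L0P qfe.
have c2 j : cj (c j ^+ 2) = c j ^+ 2 by rewrite (cj_ge0 Ks) // exprn_ge0 // ltW.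
pose A g := g - \sum_(j <- L) c j ^+ 2 *: P j g.
pose q g := `|g| ^+ 2 - \sum_(j <- L) c j ^+ 2 * `|P j g| ^+ 2.
have AB g h : A (g - h) = A g - A h.
  rewrite /A [in RHS]opprD addrACA -opprD; congr (_ - _).
  rewrite -sumrB; apply: eq_bigr => j _.
  rewrite -scaleN1r (orthprojD Ks ip_norm) // (orthprojZ Ks ip_norm) //.
  by rewrite scaleN1r scalerBr.
have ipA g h : ip (A g) h = ip g h - \sum_(j <- L) c j ^+ 2 * ip (P j g) h.
  rewrite /A ipBl; congr (_ - _).
  rewrite (big_morph (fun u => ip u h) (fun u v => ipDl ip u v h) (ip0l ip h)).
  by apply: eq_bigr => j _; rewrite ipZl.
have A_sym g h : ip (A g) h = ip g (A h).
  rewrite ipA /A ipBr; congr (_ - _).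
  rewrite (big_morph (ip g) (ipDr ip g) (ip0r ip g)).
  by apply: eq_bigr => j _; rewrite ipZr c2 (orthproj_selfadjoint Ks ip_norm).
have Aq g : ip (A g) g = q g.
  rewrite ipA ip_norm; congr (_ - _); apply: eq_bigr => j _.
  by rewrite (ip_orthproj_self Ks ip_norm).
have q0 g : 0 <= q g.
  by rewrite subr_ge0 (nneg_sums_to_ge Ks (term_ge0 g)).
have q_le g : q g <= `|g| ^+ 2 by rewrite gerBl sumr_ge0.
(* A is self-adjoint, q is its quadratic form, and 0 <= q g <= |g|^2;
   positivity of q at f - A f gives |A f|^2 <= q f *)
have Aqf : `|A f| ^+ 2 <= q f.
  have [z zE] : exists z, A f = z by exists (A f).
  rewrite zE.
  have : q (f - z) = q f + q z - `|z| ^+ 2 *+ 2.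
    by rewrite -!Aq AB zE ipBl !ipBr (A_sym z f) zE !ip_norm; ring.
  move=> /(congr1 (fun a => 0 <= a)); rewrite q0 => /esym.
  rewrite subr_ge0 mulr2n => zq.
  by have := le_trans zq (lerD (lexx (q f)) (q_le z)); rewrite lerD2r.
rewrite -(ltr_pXn2r (n := 2)) ?nnegrE ?(ltW e0) //.
apply: (le_lt_trans Aqf); apply: le_lt_trans qfe.
by rewrite -/(q f) ger0_norm.
Qed.

End ParsevalFusionFrames.

(** * Fusion Riesz bases *)

Section RieszBases.
Context {K : numFieldType} {H : completeNormedModType K}.
Variables (I : choiceType) (W : I -> set H).
Hypothesis W_riesz : fusion_riesz_basis W.

(** The lower Riesz bound on a finite set containing i bounds |w i| by the norm
    of a finite sum that tends to 0. *)
Lemma riesz_unique (w : I -> H) :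
  (forall i, W i (w i)) -> sums_to w 0 -> forall i, w i = 0.
Proof.
move=> Ww w0 i; have [_ _ [C [D [C0 _ CD]]]] := W_riesz.
apply/eqP; rewrite -normr_eq0; apply/negPn/negP => wi0.
have wi : 0 < `|w i| by rewrite lt_def wi0 /=.
have C1 : 0 < C + 1 by rewrite ltr_wpDl // ltW.
(* d does duty for a square root of C, which K need not contain: d^2 <= C *)
pose d := C / (C + 1); have d0 : 0 < d by rewrite divr_gt0.
have dC : d ^+ 2 <= C.
  rewrite expr_div_n ler_pdivrMr ?exprn_gt0 // expr2 ler_pM2l //.
  apply: (@le_trans _ _ (C + 1)); first by rewrite lerDl.
  by rewrite expr2 ler_peMl // ?(ltW C1) // lerDr ltW.
have [|L0 L0P] := w0 (d * `|w i|); first exact: mulr_gt0.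
have := L0P _ (fsubsetUl L0 [fset i]%fset); set L := (_ `|` _)%fset => Lw.
have Li : i \in L by rewrite !inE eqxx orbT.
have /andP[] := CD L w (fun j _ => Ww j); move=> + _.
rewrite sub0r normrN in Lw.
have Lw2 : `|\sum_(j <- L) w j| ^+ 2 < (d * `|w i|) ^+ 2.
  by rewrite ltr_pXn2r ?nnegrE // mulr_ge0 ?(ltW d0).
move=> /le_lt_trans/(_ Lw2); rewrite exprMn => lt_d.
have : C * `|w i| ^+ 2 <= C * \sum_(j <- L) `|w j| ^+ 2.
  by rewrite ler_pM2l // (big_fsetD1 i) //= lerDl sumr_ge0.
move=> /le_lt_trans/(_ lt_d); rewrite ltr_pM2r ?exprn_gt0 //.
by move=> /lt_le_trans/(_ dC); rewrite ltxx.
Qed.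

End RieszBases.

(** * Scalable one-excess fusion frames split *)

Section ScalableSplits.
Context {K : numFieldType} {cj : K -> K} (Ks : hilbert_scalars cj).
Context {H : completeNormedModType K} (ip : {dot H for cj}).
Hypothesis ip_norm : forall u : H, ip u u = `|u| ^+ 2.
Variables (I : choiceType) (W : I -> set H) (x : H) (xs : I -> H).
Hypothesis W_riesz : fusion_riesz_basis W.
Hypothesis xs_in : forall i, W i (xs i).
Hypothesis x_sum : sums_to xs x.
Hypothesis x_neq0 : x != 0.
Variables U T : {linear H -> H}.
Hypotheses (U_cont : continuous U) (T_cont : continuous T).
Hypotheses (UK : cancel U T) (TK : cancel T U).
Local Notation V := (adjoin_subspace (cspan [set x]) W).
Variable c : option I -> K.
Hypothesis V_scalable : fusion_scalable ip U V c.
Local Notation P o := (orthproj ip (U @` V o)).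

Let W_closed i : closed_subspace (W i).
Proof. by case: W_riesz. Qed.

Let UV_closed o : closed_subspace (U @` V o).
Proof. by case: V_scalable => [[]]. Qed.

Let c_gt0 o : 0 < c o.
Proof. by case: V_scalable => [[_]]. Qed.

Let c2_gt0 o : 0 < c o ^+ 2.
Proof. exact: exprn_gt0. Qed.

Let pars f : sums_to (fun o => c o ^+ 2 * `|P o f| ^+ 2) (`|f| ^+ 2).
Proof.
have [_ /(_ f)[s [/has_sumKP Fs]]] := V_scalable.
by rewrite mul1r -eq_le => /eqP ->.
Qed.

Let recon f : sums_to (fun o => c o ^+ 2 *: P o f) f.
Proof. exact: (parseval_reconstruction Ks ip_norm). Qed.

Let U_eq0 u : U u = 0 -> u = 0.
Proof. by move=> Uu; rewrite -(UK u) Uu linear0. Qed.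

Let U_neq0 u : u != 0 -> U u != 0.
Proof. by apply: contra_neq => /U_eq0. Qed.

(** The coefficient in T (c_0^2 P_0 (U g)) = beta g x. *)
Let beta g := c None ^+ 2 * (ip (U g) (U x) / `|U x| ^+ 2).

(** Both sides are the components along W of one decomposition of g: the term of
    index 0 in the reconstruction of U g is spread over the components x_i. *)
Lemma scalable_components j g : W j g -> forall i,
  c (Some i) ^+ 2 *: T (P (Some i) (U g)) + beta g *: xs i =
    if i == j then g else 0.
Proof.
move=> Wg i; apply/eqP; rewrite -subr_eq0; apply/eqP; move: i.
have PW i : W i (T (P (Some i) (U g))).
  have [h Wh Uh] := orthproj_in Ks ip_norm (UV_closed (Some i)) (U g).
  by rewrite -Uh UK.
apply: (riesz_unique W_riesz) => [i|].
  have [W0 WD WZ _] := W_closed i.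
  apply: closed_subspaceB => //; first by apply: WD; apply: WZ.
  by case: eqP => [->|].
have := sums_to_linear T_cont (recon (U g)).
move/sums_to_option; rewrite UK /= (image_cspan1 Ks ip_norm U x) (orthproj_line Ks ip_norm) ?U_neq0 //.
rewrite !linearZ /= UK scalerA -/(beta g) => Tg.
have := sums_toB (sums_toD Tg (sums_toZ (beta g) x_sum)) (sums_to_delta j g).
rewrite scalerN subrK subrr => /eq_sums_to; apply => i.
by rewrite linearZ.
Qed.

(** If c_j^2 = 1, the components of x_j force beta (xs j) = 0, so that U x_j is
    orthogonal to U x and to every U x_i with i <> j; then U x_j is orthogonal to
    itself. *)
Lemma scalable_weight_neq1 j : xs j != 0 -> c (Some j) ^+ 2 != 1.
Proof.
move=> xj0; apply/eqP => c1.
have := scalable_components (xs_in j) j.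
rewrite eqxx c1 scale1r (orthproj_id Ks ip_norm (UV_closed (Some j))); last by exists (xs j).
rewrite UK -[RHS]addr0 => /addrI/eqP; rewrite scaler_eq0 (negPf xj0) orbF => /eqP b0.
have Pi i : i != j -> ip (U (xs j)) (U (xs i)) = 0.
  move=> ij; have := scalable_components (xs_in j) i.
  rewrite (negPf ij) b0 scale0r addr0 => /eqP; rewrite scaler_eq0 gt_eqF //= => /eqP TP0.
  apply: (orthproj_eq0_ip Ks ip_norm (UV_closed (Some i))); last by exists (xs i).
  by rewrite -(TK (P _ _)) TP0 linear0.
have : ip (U x) (U (xs j)) = 0.
  apply: (ip_eq0C Ks); move/eqP: b0.
  rewrite /beta mulf_eq0 gt_eqF //= mulf_eq0 invr_eq0 expf_eq0 normr_eq0.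
  by rewrite (negPf (U_neq0 x_neq0)) andbF orbF => /eqP.
have ipx := sums_to_ipl Ks ip_norm (U (xs j)) (sums_to_linear U_cont x_sum).
have ipj : sums_to (fun i => ip (U (xs i)) (U (xs j))) (ip (U (xs j)) (U (xs j))).
  apply: eq_sums_to (sums_to_delta j _) _ => i.
  by case: eqP => [->//|/eqP ij]; apply/esym/(ip_eq0C Ks)/Pi.
rewrite (sums_to_unique ipx ipj) => /(ip_self_eq0 ip_norm)/U_eq0/eqP.
by rewrite (negPf xj0).
Qed.

Lemma scalable_line j : xs j != 0 -> W j = cspan [set xs j].
Proof.
move=> xj0; rewrite eqEsubset; split; last first.
  by apply: cspan_min => // _ ->.
move=> g Wg; have := scalable_components Wg j.
rewrite eqxx (orthproj_id Ks ip_norm (UV_closed (Some j))); last by exists g.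
rewrite UK => cg; rewrite (cspan1E Ks ip_norm).
exists ((1 - c (Some j) ^+ 2)^-1 * beta g) => //.
have c1 : 1 - c (Some j) ^+ 2 != 0 by rewrite subr_eq0 eq_sym scalable_weight_neq1.
rewrite -scalerA; apply: (scalerI c1); rewrite scalerKV //.
by apply/eqP; rewrite scalerBl scale1r eq_sym subr_eq addrC cg.
Qed.

Lemma scalable_orthogonal j i h w :
  xs j = 0 -> i != j -> W i h -> W j w -> ip (U h) (U w) = 0.
Proof.
move=> xj0 ij Wh Ww; have := scalable_components Wh j.
rewrite xj0 scaler0 addr0 eq_sym (negPf ij) => /eqP.
rewrite scaler_eq0 gt_eqF //= => /eqP TP0.
apply: (orthproj_eq0_ip Ks ip_norm (UV_closed (Some j))); last by exists w.
by rewrite -(TK (P _ _)) TP0 linear0.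
Qed.

Lemma scalable_orthogonal_x j w : xs j = 0 -> W j w -> ip (U x) (U w) = 0.
Proof.
move=> xj0 Ww; have ipx := sums_to_ipl Ks ip_norm (U w) (sums_to_linear U_cont x_sum).
apply: (@sums_to_eq0 _ _ I); apply: eq_sums_to ipx _ => i.
have [->|ij] := eqVneq i j; first by rewrite xj0 linear0 ip0l.
exact: (scalable_orthogonal xj0 ij (xs_in i) Ww).
Qed.

Let v o := if o is Some i then xs i else x.
Let I1 := [set o | v o <> 0].
Let I2 := [set i | xs i = 0].
Let n o := `|U (v o)|.
(** Generators with |U f_i| = 1, for which the projections onto the lines are
    h |-> <h, U f_i> U f_i and the one relation between the U f_i has the
    square-summable coefficients |U x| and - |U x_i|. *)
Let f (i : I1) := (n (val i))^-1 *: v (val i).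

Let v_neq0 (i : I1) : v (val i) != 0.
Proof. by apply/eqP; apply: set_mem (valP i). Qed.

Let n_neq0 (i : I1) : n (val i) != 0.
Proof. by rewrite normr_eq0 U_neq0. Qed.

Let V_line (i : I1) : V (val i) = cspan [set v (val i)].
Proof.
have := v_neq0 i; case: (val i) => //= j xj; exact: scalable_line.
Qed.

Let norm_Uf (i : I1) : `|U (f i)| = 1.
Proof.
rewrite /f linearZ normrZ normfV normr_id mulVf //; exact: n_neq0.
Qed.

Let P_line (i : I1) h : P (val i) h = ip h (U (f i)) *: U (f i).
Proof.
rewrite V_line -(eq_cspan_setZ _ (invr_neq0 (n_neq0 i))).
rewrite (image_cspan1 Ks ip_norm).
rewrite -/(f i) (orthproj_line Ks ip_norm); last first.
  by rewrite -normr_eq0 norm_Uf oner_eq0.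
by rewrite norm_Uf expr1n divr1.
Qed.

Let I2_compl o : ~ I1 o -> exists2 j, I2 j & o = Some j.
Proof.
by move=> /contrapT; case: o => [j|/eqP]; [exists j|rewrite (negPf x_neq0)].
Qed.

Let f_orth_W (i : I1) j w : I2 j -> W j w -> ip (U (f i)) (U w) = 0.
Proof.
move=> xj Ww; rewrite /f linearZ ipZl; have := v_neq0 i.
case: (val i) => [l|] /= vi; last by rewrite (scalable_orthogonal_x xj Ww) mulr0.
rewrite (scalable_orthogonal xj _ (xs_in l) Ww) ?mulr0 //.
by apply: contra_neq vi => ->.
Qed.

Let M := cspan (range (fun i : I1 => U (f i))).
Let N := cspan (\bigcup_(i in I2) (U @` W i)).

Let MN_orth : orthogonal_sets ip M N.
Proof.
apply: (orthogonal_cspan Ks ip_norm) => _ _ [i _ <-] [j Ij [w Ww <-]].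
exact: f_orth_W Ij Ww.
Qed.

Let P_M_eq0 h o : M h -> ~ I1 o -> P o h = 0.
Proof.
move=> Mh /I2_compl[j Ij ->]; apply: (orthproj_eq0 Ks ip_norm (UV_closed _)).
move=> w Ww; apply: MN_orth => //; apply: cspan_sub; by exists j.
Qed.

(** A vector orthogonal to both summands is killed by every P_o, so that it
    vanishes by the Parseval identity. *)
Let scalable_split : orthogonal_direct_sum ip M N.
Proof.
split=> // h; have Mcl : closed_subspace M := cspan_closed _.
have Ncl : closed_subspace N := cspan_closed _.
exists (orthproj ip M h), (h - orthproj ip M h); split.
- exact: orthproj_in.
- set u := h - _; set z := u - orthproj ip N u.
  suff z0 : z = 0.
    rewrite -(subrK (orthproj ip N u) u) -/z z0 add0r; exact: orthproj_in.
  apply: (ip_self_eq0 ip_norm); rewrite ip_norm.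
  apply: (@sums_to_eq0 _ _ (option I)); apply: eq_sums_to (pars z) _ => o.
  rewrite (orthproj_eq0 Ks ip_norm (UV_closed o)) ?normr0 ?expr0n ?mulr0 //= => w Vw.
  have [Io|/I2_compl[j Ij oj]] := pselect (I1 o).
    have Mw : M w.
      pose i : I1 := SigSub (mem_set Io).
      have V_Mw : (U @` V (val i)) `<=` M.
        rewrite V_line -(eq_cspan_setZ _ (invr_neq0 (n_neq0 i))).
        rewrite (image_cspan1 Ks ip_norm).
        by apply: (cspan_min Mcl) => _ ->; apply: cspan_sub; exists i.
      exact: V_Mw.
    rewrite /z ipBl (orthproj_residue Ks ip_norm Mcl) // sub0r.
    by rewrite (ip_eq0C Ks (MN_orth Mw (orthproj_in Ks ip_norm Ncl u))) oppr0.
  apply: (orthproj_residue Ks ip_norm Ncl); apply: cspan_sub.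
  by exists j => //; rewrite oj in Vw.
by rewrite addrC subrK.
Qed.

Let scalable_strictly : strictly_scalable ip (fun i : I1 => U (f i)) (fun i => c (val i)).
Proof.
split=> [i|h Mh] //; apply/has_sumP.
have Ph : sums_to (fun i : I1 => c (val i) ^+ 2 *: P (val i) h) h.
  apply/(@sums_to_val _ _ _ I1 (fun o => c o ^+ 2 *: P o h)) => // o.
  by move=> /(P_M_eq0 Mh)->; rewrite scaler0.
by apply: eq_sums_to Ph _ => i; rewrite P_line.
Qed.

Let scalable_orthogonal_family :
  orthogonal_family ip (fun i : I2 => U @` W (val i)).
Proof.
move=> i j ij _ _ [u Wu <-] [w Ww <-].
by apply: (scalable_orthogonal _ _ Wu Ww); [exact: set_mem (valP j)|].
Qed.

(** A Bessel bound for the unit vectors on the lines other than U V_0, which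
    follows from the upper Riesz bound of W by duality: with a_j = <h, U f_j>
    and S = sum_j a_j f_j, t = sum_j |a_j|^2 = <U S, h> satisfies
    t^2 <= |U S|^2 |h|^2 <= B t |h|^2. *)
Let bessel : exists2 B : K, 0 < B & forall h (L : {fset I}),
  \sum_(j <- L) extend0 (fun i => `|ip h (U (f i))| ^+ 2) (Some j) <= B * `|h| ^+ 2.
Proof.
have [_ _ [C [D [C0 D0 CD]]]] := W_riesz.
have [BU BU0 UB] := continuous_linear_bound U_cont.
have [BT BT0 TB] := continuous_linear_bound T_cont.
exists (BU ^+ 2 * (D * BT ^+ 2)) => [|h L].
  by rewrite !mulr_gt0 ?exprn_gt0.
pose a j := extend0 (fun i => ip h (U (f i))) (Some j) : K.
pose fe j := extend0 f (Some j).
have -> : \sum_(j <- L) extend0 (fun i => `|ip h (U (f i))| ^+ 2) (Some j) =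
    \sum_(j <- L) `|a j| ^+ 2.
  apply: eq_bigr => j _; rewrite /a /extend0; case: pselect => // _.
  by rewrite normr0 expr0n.
set t := \sum_(j <- L) `|a j| ^+ 2.
have t0 : 0 <= t by rewrite sumr_ge0.
have fe_in j : W j (a j *: fe j).
  have [W0 _ WZ _] := W_closed j; apply: (WZ).
  rewrite /fe /extend0; case: pselect => [Io|_] //.
  exact: WZ (xs_in j).
have fe_norm j : `|fe j| <= BT.
  rewrite /fe /extend0; case: pselect => [Io|_]; last by rewrite normr0 ltW.
  set i := SigSub _; rewrite -(UK (f i)) (le_trans (TB _)) //.
  by rewrite norm_Uf mulr1.
pose S := \sum_(j <- L) a j *: fe j.
have S_le : `|U S| ^+ 2 <= BU ^+ 2 * (D * BT ^+ 2) * t.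
  apply: (@le_trans _ _ (BU ^+ 2 * `|S| ^+ 2)).
    by rewrite -exprMn ler_pXn2r ?nnegrE ?mulr_ge0 // ltW.
  rewrite -mulrA ler_pM2l ?exprn_gt0 //.
  have /andP[_ /le_trans] := CD L (fun j => a j *: fe j) (fun j _ => fe_in j).
  apply; rewrite -mulrA ler_pM2l // /t mulr_sumr; apply: ler_sum => j _.
  rewrite normrZ exprMn mulrC ler_wpM2r ?exprn_ge0 //.
  by rewrite ler_pXn2r ?nnegrE // ltW.
have tS : t = ip (U S) h.
  rewrite /S linear_sum (big_morph (fun u => ip u h) (fun u v => ipDl ip u v h) (ip0l ip h)).
  apply: eq_bigr => j _; rewrite linearZ ipZl -(mulr_cj Ks); congr (_ * _).
  rewrite /a /fe; have [Io|nIo] := pselect (I1 (Some j)); last first.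
    by rewrite !extend0_out // linear0 ip0l (cj_ge0 Ks).
  pose i : I1 := SigSub (mem_set Io).
  by rewrite !(extend0_val _ i) [RHS]ipC.
have [t_eq0|t_neq0] := eqVneq t 0.
  by rewrite t_eq0 !mulr_ge0 ?exprn_ge0 // ltW.
have tp : 0 < t by rewrite lt_def t_neq0.
have tt : t * t = `|ip (U S) h| ^+ 2 by rewrite -tS ger0_norm // expr2.
rewrite -(ler_pM2r tp) tt mulrAC; apply: (@le_trans _ _ (`|U S| ^+ 2 * `|h| ^+ 2)).
  rewrite -exprMn ler_pXn2r ?nnegrE ?mulr_ge0 //.
  exact: cauchy_schwarz.
by rewrite ler_wpM2r ?exprn_ge0.
Qed.

(** Above, a Bessel bound, with one more for the line of U x.  Below, the
    weights are at most 1, so that dropping them from the Parseval identity can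
    only increase the sum. *)
Let scalable_frame_sequence : frame_sequence ip (fun i : I1 => U (f i)).
Proof.
have [B B0 Bh] := bessel; exists 1, (B + 1); split=> //.
split=> [|h Mh]; first by rewrite lerDr ltW.
pose G (i : I1) := `|ip h (U (f i))| ^+ 2 : K.
have G0 i : 0 <= G i by rewrite exprn_ge0.
have Ge0 o : 0 <= extend0 G o by rewrite /extend0; case: pselect.
have [s [Gs _ sB]] := nneg_sums_to_bounded Ks (fun j => Ge0 (Some j)) (Bh h).
have {}Gs : sums_to G (s + extend0 G None).
  by apply/sums_to_extend0/sums_to_option; rewrite addrK.
exists (s + extend0 G None); split; first exact/has_sumKP.
apply/andP; split; last first.
  rewrite mulrDl lerD // mul1r /extend0; case: pselect => [Io|_]; last exact: exprn_ge0.
  rewrite /G ler_pXn2r ?nnegrE //; apply: le_trans (cauchy_schwarz Ks ip_norm _ _) _.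
  by rewrite norm_Uf mulr1.
have cG : sums_to (fun i : I1 => c (val i) ^+ 2 * G i) (`|h| ^+ 2).
  have : sums_to (fun i : I1 => c (val i) ^+ 2 * `|P (val i) h| ^+ 2) (`|h| ^+ 2).
    apply/(@sums_to_val _ _ _ I1 (fun o => c o ^+ 2 * `|P o h| ^+ 2)) => // o.
    by move=> /(P_M_eq0 Mh)->; rewrite normr0 expr0n mulr0.
  move=> /eq_sums_to; apply => i.
  by rewrite P_line normrZ norm_Uf mulr1.
rewrite mul1r; apply: (nneg_sums_to_le Ks _ _ cG) => [i|L].
  by rewrite mulr_ge0 // ltW.
apply: le_trans (nneg_sums_to_ge Ks G0 L Gs); apply: ler_sum => i _.
rewrite ler_piMl //; apply: (parseval_weight_le1 Ks ip_norm UV_closed c_gt0 _ _ (pars (U (f i)))).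
  exists (f i) => //; rewrite V_line /f; have [_ _ MZ _] := cspan_closed [set v (val i)].
  by apply: MZ; apply: cspan_sub.
by rewrite -normr_eq0 norm_Uf oner_eq0.
Qed.

(** The lower Riesz bound controls sum |x_j|^2 by the finite sums of x_j, which
    are eventually within 1 of x. *)
Let norms_summable : exists s, sums_to (fun j => `|U (xs j)| ^+ 2) s.
Proof.
have [_ _ [C [D [C0 D0 CD]]]] := W_riesz.
have [BU BU0 UB] := continuous_linear_bound U_cont.
have F0 j : 0 <= `|U (xs j)| ^+ 2 by rewrite exprn_ge0.
have [L0 L0P] := x_sum ltr01.
have [|s [Fs _ _]] := nneg_sums_to_bounded Ks F0
  (B := BU ^+ 2 * ((`|x| + 1) ^+ 2 / C)); last by exists s.
move=> L; apply: (le_trans (nneg_sum_mono F0 (fsubsetUr L0 L))).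
have /L0P := fsubsetUl L0 L; set L1 := (L0 `|` L)%fset => xL.
apply: (@le_trans _ _ (BU ^+ 2 * \sum_(j <- L1) `|xs j| ^+ 2)).
  rewrite mulr_sumr; apply: ler_sum => j _.
  by rewrite -exprMn ler_pXn2r ?nnegrE ?mulr_ge0 // ltW.
rewrite ler_pM2l ?exprn_gt0 // ler_pdivlMr // mulrC.
have /andP[/le_trans + _] := CD L1 xs (fun j _ => xs_in j); apply.
rewrite ler_pXn2r ?nnegrE ?addr_ge0 // -lerBlDl (le_trans (lerB_dist _ _)) //.
by rewrite distrC ltW.
Qed.

Let sgn (o : option I) : K := if o is Some _ then -1 else 1.

(** A relation sum_i d_i U f_i = 0 pulls back to d_0 f_0 = - sum_j d_j f_j.
    Comparing it with x = sum_j x_j along the Riesz basis, d is a multiple of the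
    relation U x - sum_j U x_j = 0. *)
Let scalable_excess : excess (fun i : I1 => U (f i)) 1.
Proof.
have INone : I1 None by apply/eqP.
pose i0 : I1 := SigSub (mem_set INone).
pose b (_ : 'I_1) (i : I1) : K^o := sgn (val i) * n (val i).
exists b; split=> [a|].
  rewrite big_ord1 => ab i; rewrite ord1.
  move: (congr1 (fun g : I1 -> K^o => g i0) ab) => /= /eqP.
  rewrite [_ == _](_ : _ = (a ord0 * (1 * n None) == 0)) // mul1r mulf_eq0.
  by rewrite (negPf (n_neq0 i0)) orbF => /eqP.
rewrite eqEsubset; split=> [d /= [_ /has_sumP d0]|_ /= [a ->]].
  pose k := d i0 / n None.
  have dx i : d i = k * b ord0 i.
    have := sums_to_linear T_cont d0; rewrite linear0.
    have Tf (l : I1) : T (d l *: U (f l)) = d l *: f l by rewrite linearZ UK.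
    move=> /eq_sums_to/(_ Tf)/sums_to_extend0/sums_to_option.
    rewrite (extend0_val _ i0) sub0r => df.
    have {}df : sums_to (fun j => extend0 (fun l => d l *: f l) (Some j) + k *: xs j) 0.
      have := sums_toD df (sums_toZ k x_sum).
      by rewrite /f /= scalerA addNr.
    have df0 := riesz_unique W_riesz _ df.
    have {}df0 j : extend0 (fun l => d l *: f l) (Some j) + k *: xs j = 0.
      apply: df0 => {}j; have [W0 WD WZ _] := W_closed j.
      apply: WD; last exact: WZ.
      rewrite /extend0; case: pselect => [Io|_] //.
      by apply: (WZ); apply: WZ (xs_in j).
    rewrite /b; case vi : (val i) => [j|] /=; last first.
      by rewrite mul1r divfK ?(n_neq0 i0) //; congr d; apply: val_inj; rewrite vi.
    have := df0 j; rewrite -vi extend0_val /f scalerA.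
    have -> : xs j = v (val i) by rewrite vi.
    rewrite -scalerDl => /eqP; rewrite scaler_eq0 (negPf (v_neq0 i)) orbF.
    rewrite addr_eq0 => /eqP dn; rewrite -(divfK (n_neq0 i) (d i)) dn.
    by rewrite mulN1r mulrN mulNr.
  exists (fun=> k); rewrite big_ord1; apply/funext => i; exact: dx.
rewrite big_ord1; set d := a ord0 *: b ord0.
have dE i : d i = a ord0 * (sgn (val i) * n (val i)) by [].
split.
  have [s Fs] := norms_summable.
  exists (`|a ord0| ^+ 2 * (s + n None ^+ 2)); apply/has_sumKP.
  have : sums_to (fun o => `|a ord0| ^+ 2 * n o ^+ 2) (`|a ord0| ^+ 2 * (s + n None ^+ 2)).
    apply: (@sums_to_addmap _ _ _ _ ( *%R (`|a ord0| ^+ 2)) (`|a ord0| ^+ 2)) => //.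
    - by move=> u w; rewrite mulrDr.
    - by move=> u; rewrite normrM ger0_norm ?exprn_ge0.
    by apply/sums_to_option; rewrite addrK.
  have F0 o : ~ I1 o -> `|a ord0| ^+ 2 * n o ^+ 2 = 0.
    by move=> /contrapT vo; rewrite /n vo linear0 normr0 expr0n mulr0.
  move=> /(sums_to_val _ F0).2 /eq_sums_to; apply => i.
  rewrite dE !normrM !exprMn /n normr_id; congr (_ * _).
  by rewrite /sgn; case: (val i) => [l|]; rewrite ?normrN normr1 expr1n mul1r.
apply/has_sumP.
have : sums_to (fun o => (a ord0 * sgn o) *: U (v o)) 0.
  apply/sums_to_option; rewrite sub0r mulr1 -scaleNr.
  apply: eq_sums_to (sums_toZ (- a ord0) (sums_to_linear U_cont x_sum)) _ => j.
  by rewrite mulrN1.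
have F0 o : ~ I1 o -> (a ord0 * sgn o) *: U (v o) = 0.
  by move=> /contrapT vo; rewrite vo linear0 scaler0.
move=> /(sums_to_val _ F0).2 /eq_sums_to; apply => i.
by rewrite dE /f linearZ scalerA -!mulrA mulfV ?mulr1 // n_neq0.
Qed.

(** The splitting is I_1 = {0} and the j with x_j <> 0, against the j with
    x_j = 0; the coefficients are the given weights. *)
Theorem scalable_splits :
  exists (I1 : set (option I)) (I2 : set I) (f : I1 -> H) (gam : I1 -> K),
    I1 `&` (Some @` I2) = set0 /\ I1 `|` (Some @` I2) = setT /\
    (forall i : I1, 0 < gam i) /\
    (forall i : I1, V (val i) = cspan [set f i]) /\
    orthogonal_direct_sum ip
      (cspan (range (fun i : I1 => U (f i))))
      (cspan (\bigcup_(i in I2) (U @` W i))) /\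
    frame_sequence ip (fun i : I1 => U (f i)) /\
    excess (fun i : I1 => U (f i)) 1 /\
    strictly_scalable ip (fun i : I1 => U (f i)) gam /\
    orthogonal_family ip (fun i : I2 => U @` W (val i)).
Proof.
exists I1, I2, f, (fun i => c (val i)); split.
  by rewrite eqEsubset; split=> // o [vo [j xj jo]]; apply: vo; rewrite -jo.
split.
  rewrite eqEsubset; split=> // o _.
  have [|/I2_compl[j Ij ->]] := pselect (I1 o); [by left|].
  by right; exists j.
split=> //; split=> [i|]; first by rewrite V_line eq_cspan_setZ ?invr_neq0.
by do ![split=> //].
Qed.

End ScalableSplits.

(** * Split fusion frames are scalable *)

Section OrthogonalFamilies.
Context {K : numFieldType} {cj : K -> K} (Ks : hilbert_scalars cj).
Context {H : completeNormedModType K} (ip : {dot H for cj}).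
Hypothesis ip_norm : forall u : H, ip u u = `|u| ^+ 2.
Variables (J : choiceType) (Y : J -> set H).
Hypothesis Y_closed : forall j, closed_subspace (Y j).
Hypothesis Y_orth : orthogonal_family ip Y.
Local Notation P j := (orthproj ip (Y j)).

(** The finite sum of projections is the projection onto the span of the Y_j
    with j in L. *)
Lemma norm_sum_orthproj_le (L : {fset J}) u : `|\sum_(j <- L) P j u| <= `|u|.
Proof.
set S := \sum_(j <- L) P j u.
have Sw j : j \in L -> ip (P j u) S = ip (P j u) u.
  move=> Lj; rewrite (ip_orthproj_self Ks ip_norm) // -ip_norm.
  rewrite /S (big_morph (ip (P j u)) (ipDr ip _) (ip0r ip _)).
  rewrite (big_fsetD1 j) //= big1_fset ?addr0 // => i.
  rewrite !inE => /andP[ij _] _.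
  by apply: (Y_orth (i := j) (j := i)); rewrite 1?eq_sym //; apply: orthproj_in.
have SS : `|S| ^+ 2 = ip S u.
  rewrite -ip_norm {1 3}/S.
  rewrite !(big_morph (fun v => ip v _) (fun v w => ipDl ip v w _) (ip0l ip _)).
  by rewrite big_seq [RHS]big_seq; apply: eq_bigr => j /Sw.
have [->|S0] := eqVneq S 0; first by rewrite normr0.
have Sp : 0 < `|S| by rewrite normr_gt0.
rewrite -(ler_pM2l Sp) -expr2 -[leLHS]ger0_norm ?exprn_ge0 // SS.
exact: cauchy_schwarz.
Qed.

(** The vectors that are the sum of their projections form a closed subspace, as
    the finite sums of projections are uniformly bounded. *)
Lemma orthogonal_family_sum v :
  cspan (\bigcup_j Y j) v -> sums_to (fun j => P j v) v.
Proof.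
apply: (@cspan_min _ _ _ [set v | sums_to (fun j => P j v) v]); last first.
  move=> w [j _ Yw] /=; apply: eq_sums_to (sums_to_delta j w) _ => i.
  case: eqP => [->|/eqP ij]; first by rewrite (orthproj_id Ks ip_norm).
  rewrite (orthproj_eq0 Ks ip_norm) // => w' Yw'.
  by apply: Y_orth Yw Yw'; rewrite eq_sym.
split=> /=.
- have P0 j : P j 0 = 0 by apply: (orthproj_eq0 Ks ip_norm) => // w _; rewrite ip0l.
  move=> e e0; exists fset0 => L _; rewrite big1 ?subrr ?normr0 // => j _.
- move=> u w Pu Pw; apply: eq_sums_to (sums_toD Pu Pw) _ => j.
  by rewrite (orthprojD Ks ip_norm).
- move=> a u Pu; apply: eq_sums_to (sums_toZ a Pu) _ => j.
  by rewrite (orthprojZ Ks ip_norm).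
apply/closed_approxP => u uP e e0; have e30 : 0 < e / 3 by rewrite divr_gt0.
have [w Pw uw] := uP _ e30; have [L0 L0P] := Pw _ e30.
exists L0 => L /L0P wL.
have -> : u - \sum_(j <- L) P j u =
    (u - w) + (w - \sum_(j <- L) P j w) - \sum_(j <- L) P j (u - w).
  have -> : \sum_(j <- L) P j (u - w) = \sum_(j <- L) P j u - \sum_(j <- L) P j w.
    rewrite -sumrB; apply: eq_bigr => j _.
    by rewrite -scaleN1r (orthprojD Ks ip_norm) // (orthprojZ Ks ip_norm) // scaleN1r.
  by rewrite subrKA opprB addrA subrK.
apply: le_lt_trans (ler_normB _ _) _.
have -> : e = e / 3 + e / 3 + e / 3 by field.
apply: ltr_leD; last exact: le_trans (norm_sum_orthproj_le _ _) (ltW uw).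
by apply: le_lt_trans (ler_normD _ _) _; apply: ltrD.
Qed.

End OrthogonalFamilies.

Section InvertibleSums.
Context {K : numFieldType} {H : normedModType K}.

(** Where the series diverges, its sum takes one default value, at u as well as
    at 2 u; so an injective sum of homogeneous maps converges everywhere. *)
Lemma sum_converges (J : choiceType) (Phi : J -> H -> H) (N : set H) :
  (forall j a u, Phi j (a *: u) = a *: Phi j u) -> closed_subspace N ->
  {in N &, injective (fun u => sum (fun j => Phi j u))} ->
  forall m, N m -> sums_to (fun j => Phi j m) (sum (fun j => Phi j m)).
Proof.
move=> PhiZ [_ _ NZ _] sum_inj m Nm.
have FF := @totally_filter J.
have [cv|ncv] := pselect (cvg (partial_sum (fun j => Phi j m) @ totally)).
  by apply/has_sumP; exact: cv.
have n2 : ~ cvg (partial_sum (fun j => Phi j (2 *: m)) @ totally).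
  move=> /cvg_ex[l /= /has_sumP/(sums_toZ 2^-1) h]; apply: ncv.
  apply/cvg_ex; exists (2^-1 *: l); apply/has_sumP; apply: eq_sums_to h _ => j.
  by rewrite PhiZ scalerK.
have : m = 2 *: m.
  apply: sum_inj; rewrite ?inE //; first exact: NZ.
  by rewrite /sum; apply: (etrans (dvgP ncv)); exact: esym (dvgP n2).
move=> m2; have m0 : m = 0.
  by apply: (addrI m); rewrite addr0 -mulr2n -scaler_nat -m2.
case: ncv; apply/cvg_ex; exists 0; apply/has_sumP => e e0; exists fset0 => L _.
rewrite big1 ?subrr ?normr0 // => j _.
by rewrite m0 -(scale0r 0) PhiZ !scale0r.
Qed.

Lemma set_bij_pinv (A B : set H) (S : H -> H) (dflt : H -> H) h :
  set_bij A B S -> B h -> A ('pinv_dflt A S h) /\ S ('pinv_dflt A S h) = h.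
Proof.
move=> S_bij Bh; split.
  by have /set_bij_homo := bijpinv_bij dflt S_bij; apply.
by apply: pinvK; rewrite inE; exact: (set_bij_surj S_bij Bh).
Qed.

End InvertibleSums.

Section SplitScalable.
Context {K : numFieldType} {cj : K -> K} (Ks : hilbert_scalars cj).
Context {H : completeNormedModType K} (ip : {dot H for cj}).
Hypothesis ip_norm : forall u : H, ip u u = `|u| ^+ 2.
Variables (I : choiceType) (W : I -> set H) (V : option I -> set H).
Hypothesis V_closed : forall o, closed_subspace (V o).
Hypothesis V_some : forall i, V (Some i) = W i.
Variables U T : {linear H -> H}.
Hypotheses (U_cont : continuous U) (T_cont : continuous T).
Hypotheses (UK : cancel U T) (TK : cancel T U).
Variables (I1 : set (option I)) (I2 : set I) (f : I1 -> H) (gam : I1 -> K).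
Hypothesis I12_disj : I1 `&` (Some @` I2) = set0.
Hypothesis I12_cover : I1 `|` (Some @` I2) = setT.
Hypothesis V_line : forall i : I1, V (val i) = cspan [set f i].

Section Orthogonal.
Hypothesis split : orthogonal_direct_sum ip
  (cspan (range (fun i : I1 => U (f i)))) (cspan (\bigcup_(i in I2) (U @` W i))).
Hypothesis f_scalable : strictly_scalable ip (fun i : I1 => U (f i)) gam.
Hypothesis W_orth : orthogonal_family ip (fun i : I2 => U @` W (val i)).

Let UV_closed o : closed_subspace (U @` V o).
Proof.
rewrite (_ : U @` V o = T @^-1` V o); first exact: closed_subspace_preimage.
rewrite eqEsubset; split=> [_ [u Vu <-]|u Vu]; first by rewrite /preimage /= UK.
by exists (T u) => //; rewrite TK.
Qed.

Local Notation P o := (orthproj ip (U @` V o)).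

(** gam_i^2 <., U f_i> U f_i is a multiple of the projection onto the line of
    U f_i, and the weight absorbs the factor; on a null line any weight does. *)
Lemma split_weight o : exists w : K, [/\ 0 < w,
  (forall i : I1, val i = o -> forall h,
     w ^+ 2 * `|P o h| ^+ 2 = gam i ^+ 2 * `|ip h (U (f i))| ^+ 2) &
  (~ I1 o -> w = 1)].
Proof.
have [gam0 _] := f_scalable.
have [Io|nIo] := pselect (I1 o); last first.
  by exists 1; split=> // i io; case: nIo; rewrite -io; exact: set_mem (valP i).
pose i : I1 := SigSub (mem_set Io).
have UVo : U @` V o = cspan [set U (f i)].
  have -> : V o = cspan [set f i] := V_line i.
  exact: (image_cspan1 Ks ip_norm).
have uniq_i (j : I1) : val j = o -> j = i by move=> jo; apply: val_inj; rewrite jo.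
have [fi0|fi0] := eqVneq (U (f i)) 0.
  exists 1; split=> // _ /uniq_i-> h.
  have := orthproj_in Ks ip_norm (UV_closed o) h.
  by rewrite {1}UVo fi0 cspan0 => ->; rewrite ip0r !normr0 expr0n !mulr0.
have n0 : `|U (f i)| != 0 by rewrite normr_eq0.
exists (gam i * `|U (f i)|); split=> // [|_ /uniq_i-> h].
  by rewrite mulr_gt0 // normr_gt0.
rewrite UVo (orthproj_line Ks ip_norm) // normrZ normrM normfV normrX normr_id.
by field.
Qed.

Theorem split_scalable : exists c : option I -> K, fusion_scalable ip U V c.
Proof.
have [c cP] := boolp.choice split_weight; exists c.
split; first by split=> // o; case: (cP o).
move=> h; exists (`|h| ^+ 2); split; last by rewrite mul1r lexx.
apply/has_sumKP; have [MN /(_ h)[u [v [Mu Nv hE]]]] := split.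
have [gam0 fsum] := f_scalable.
have Mf (i : I1) : cspan (range (fun i : I1 => U (f i))) (U (f i)).
  by apply: cspan_sub; exists i.
have sum1 : sums_to (fun i : I1 => c (val i) ^+ 2 * `|P (val i) h| ^+ 2) (`|u| ^+ 2).
  have /has_sumP/(sums_to_ipl Ks ip_norm u) := fsum u Mu; rewrite ip_norm.
  move=> /eq_sums_to; apply => i.
  have [_ cPi _] := cP (val i); rewrite (cPi i) //.
  rewrite hE ipDl (ip_eq0C Ks (MN _ _ (Mf i) Nv)) addr0 !ipZl.
  by rewrite -(mulr_cj Ks) -(ipC ip).
pose Y (j : I2) := U @` W (val j).
have Y_closed j : closed_subspace (Y j).
  by rewrite /Y -V_some; exact: UV_closed.
have sum2 : sums_to
    (fun j : I2 => c (Some (val j)) ^+ 2 * `|P (Some (val j)) h| ^+ 2) (`|v| ^+ 2).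
  have Yv : cspan (\bigcup_j Y j) v.
    move: Nv; apply: cspan_min; first exact: cspan_closed.
    move=> w [j Ij Yw]; apply: cspan_sub; exists (SigSub (mem_set Ij)) => //.
  have := sums_to_ipl Ks ip_norm v (orthogonal_family_sum Ks ip_norm Y_closed W_orth Yv).
  rewrite ip_norm => /eq_sums_to; apply => j.
  have [_ _ -> //] := cP (Some (val j)); last first.
    move=> Ij; suff : (I1 `&` (Some @` I2)) (Some (val j)) by rewrite I12_disj.
    by split=> //; exists (val j) => //; exact: set_mem (valP j).
  rewrite V_some expr1n mul1r (ip_orthproj_self Ks ip_norm (Y_closed j)).
  congr (`|_| ^+ 2); rewrite hE (orthprojD Ks ip_norm (Y_closed j)).
  rewrite [orthproj _ _ u](orthproj_eq0 Ks ip_norm (Y_closed j)) ?add0r // => w Yw.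
  by apply: MN => //; apply: cspan_sub; exists (val j) => //; exact: set_mem (valP j).
pose F o := c o ^+ 2 * `|P o h| ^+ 2.
pose F1 o := if pselect (I1 o) then F o else 0.
pose F2 o := if pselect (I1 o) then 0 else F o.
have -> : `|h| ^+ 2 = `|u| ^+ 2 + `|v| ^+ 2.
  by rewrite hE (pythagoras Ks ip_norm) // MN.
have S1 : sums_to F1 (`|u| ^+ 2).
  apply/(@sums_to_val _ _ _ I1) => [p|]; first by rewrite /F1; case: pselect.
  apply: eq_sums_to sum1 _ => i; rewrite /F1; case: pselect => // nIi.
  case: nIi; exact: set_mem (valP i).
have S2 : sums_to F2 (`|v| ^+ 2).
  apply/(@sums_to_inj _ _ _ _ (fun j : I2 => Some (val j))).
  - by move=> i j [/val_inj].
  - move=> o no; rewrite /F2; case: pselect => // nIo.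
    have : (I1 `|` (Some @` I2)) o by rewrite I12_cover.
    by case=> [//|[j Ij jo]]; case: (no (SigSub (mem_set Ij))); rewrite SubK.
  apply: eq_sums_to sum2 _ => j; rewrite /F2 /=; case: pselect => // Ij.
  suff : (I1 `&` (Some @` I2)) (Some (val j)) by rewrite I12_disj.
  by split=> //; exists (val j) => //; exact: set_mem (valP j).
apply: eq_sums_to (sums_toD S1 S2) _ => o; rewrite /F1 /F2 /F.
by case: pselect => _ /=; rewrite ?addr0 ?add0r.
Qed.

End Orthogonal.

Section FrameOperators.
Hypothesis W_riesz : fusion_riesz_basis W.
Hypothesis gam_gt0 : forall i, 0 < gam i.
Let M := cspan (range f).
Let N := cspan (\bigcup_(i in I2) W i).
Let SF := frame_operator ip (fun i : I1 => gam i *: f i).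
Let SW := fusion_frame_operator ip (fun i : I2 => W (val i)) (fun=> 1).

(** For h = U g with g in M and m = U^* h, the coefficients of m and of h agree,
    <m, f_i> = <h, U f_i>, and applying U to S m = g gives the reconstruction
    of h. *)
Lemma strictly_scalable_of_adjoint : set_bij M M SF ->
  (forall g, M g -> adjoint ip U (U g) = 'pinv_(fun=> 0) M SF g) ->
  strictly_scalable ip (fun i : I1 => U (f i)) gam.
Proof.
move=> SF_bij adjE; split=> // h Mh; apply/has_sumP.
have MTh : M (T h).
  have : forall u, range (fun i : I1 => U (f i)) u -> cspan (range f) (T u).
    by move=> _ [i _ <-]; rewrite UK; apply: cspan_sub; exists i.
  by move/(cspan_preimage T_cont)/(_ _ Mh).
have := set_bij_pinv (fun=> 0) SF_bij MTh; rewrite -adjE // TK.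
set m := adjoint ip U h => -[Mm SFm].
have ipm g : ip (U g) h = ip g m by rewrite (adjointP Ks ip_norm _ _ U_cont).
have SF_lin (i : I1) a u : ip (a *: u) (gam i *: f i) *: (gam i *: f i) =
    a *: (ip u (gam i *: f i) *: (gam i *: f i)).
  by rewrite ipZl -scalerA.
have := sum_converges SF_lin (cspan_closed _) (set_bij_inj SF_bij) Mm.
rewrite -/(frame_operator _ _ _) -/SF SFm => /(sums_to_linear U_cont); rewrite TK.
move=> /eq_sums_to; apply => i.
rewrite ipZr (cj_ge0 Ks) ?(ltW (gam_gt0 i)) //.
rewrite [U (_ *: (_ *: _))]linearZ /= [U (gam i *: _)]linearZ /=.
rewrite (ipC ip m) -ipm -(ipC ip) !scalerA; congr (_ *: _); ring.
Qed.

(** For w in W_j, m = U^* U w satisfies sum_i P_(W_i) m in W_j, so that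
    P_(W_i) m = 0 for i <> j in I_2 and <U u, U w> = <u, m> = 0 for u in W_i. *)
Lemma orthogonal_family_of_adjoint : set_bij N N SW ->
  (forall i : I2, (fun g => adjoint ip U (U g)) @` W (val i) =
     'pinv_(fun=> 0) N SW @` W (val i)) ->
  orthogonal_family ip (fun i : I2 => U @` W (val i)).
Proof.
move=> SW_bij adjE i j ij _ _ [u Wu <-] [w Ww <-].
have W_closed l : closed_subspace (W l) by rewrite -V_some.
set m := adjoint ip U (U w).
have /= [w' Ww' mE] : ('pinv_(fun=> 0) N SW @` W (val j)) m by rewrite -adjE; exists w.
have Nw' : N w'.
  by apply: cspan_sub; exists (val j) => //; exact: set_mem (valP j).
have := set_bij_pinv (fun=> 0) SW_bij Nw'; rewrite mE => -[Nm SWm].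
rewrite (adjointP Ks ip_norm _ _ U_cont) -/m.
have SW_lin (l : I2) a h : 1 ^+ 2 *: orthproj ip (W (val l)) (a *: h) =
    a *: (1 ^+ 2 *: orthproj ip (W (val l)) h) :> H.
  by rewrite (orthprojZ Ks ip_norm) // expr1n !scale1r.
have := sum_converges SW_lin (cspan_closed _) (set_bij_inj SW_bij) Nm.
rewrite -/(fusion_frame_operator _ _ _ _) -/SW SWm.
move=> /(fun s => sums_toB s (sums_to_delta j w')); rewrite subrr.
set d := fun l : I2 => _ => d0.
have d_eq0 l : extend0 d l = 0.
  apply: (riesz_unique W_riesz) => [{}l|]; last exact/sums_to_extend0.
  have [W0 _ _ _] := W_closed l; rewrite /extend0; case: pselect => [Il|_] //.
  rewrite /d; apply: closed_subspaceB => //.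
    by rewrite expr1n scale1r; exact: orthproj_in.
  by case: eqP => [lj|_] //; have <- : val j = l by rewrite -lj SubK.
have := d_eq0 (val i); rewrite extend0_val /d (negPf ij) subr0 expr1n scale1r => Pm.
apply: (ip_eq0C Ks).
exact: (orthproj_eq0_ip Ks ip_norm (W_closed _) Pm).
Qed.

End FrameOperators.

End SplitScalable.

(** * The equivalence *)

(** If x = 0, the Riesz basis alone carries the synthesis kernel, which is then
    zero. *)
Lemma excess1_neq0 (K : numFieldType) (H : completeNormedModType K)
    (I : choiceType) (W : I -> set H) (x : H) :
  fusion_riesz_basis W ->
  fusion_excess (adjoin_subspace (cspan [set x]) W) (fun=> 1) 1 -> x != 0.
Proof.
move=> W_riesz [b [b_free kerE]]; apply/eqP => x0.
have : fusion_synthesis_kernel (adjoin_subspace (cspan [set x]) W) (fun=> 1) (b ord0).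
  rewrite kerE; exists (fun=> 1); by rewrite big_ord1 scale1r.
move=> [Vb [_ /has_sumP b_sum]].
have bN : b ord0 None = 0 by have := Vb None; rewrite /= x0 cspan0.
have bS i : b ord0 (Some i) = 0.
  apply: (riesz_unique W_riesz (fun j => Vb (Some j))).
  move/sums_to_option: b_sum; rewrite bN scaler0 subr0 => /eq_sums_to; apply => j.
  by rewrite scale1r.
have : (1 : K) = 0; last by move/eqP; rewrite oner_eq0.
apply: (b_free (fun=> 1) _ ord0); rewrite big_ord1 scale1r.
by apply/funext => -[i|].
Qed.

Unset Implicit Arguments.
Set Strict Implicit.

Theorem theorem3p3 (R : realType) (k : scalar_kind)
    (H : completeNormedModType (base_field R k))
    (ip : {dot H for @base_conj R k})
    (ip_norm : forall u : H, ip u u = `|u| ^+ 2)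
    (H_separable : separable_space H)
    (I : countType) (W : I -> set H)
    (W_riesz : fusion_riesz_basis W)
    (x : H) (xs : I -> H)
    (xs_in : forall i, W i (xs i))
    (x_sum : has_sum (fun i : [set i : I | xs i <> 0] => xs (val i)) x)
    (V : option I -> set H)
    (V_def : V = adjoin_subspace (cspan [set x]) W)
    (V_frame : fusion_frame ip V (fun=> 1))
    (V_excess : fusion_excess V (fun=> 1) 1)
    (U : {linear H -> H}) (U_cont : continuous U) (U_inv : invertible_op U) :
  (exists gam : option I -> base_field R k, fusion_scalable ip U V gam)
  <->
  (exists (I1 : set (option I)) (I2 : set I)
      (f : I1 -> H) (gam : I1 -> base_field R k),
    I1 `&` (Some @` I2) = set0 /\ I1 `|` (Some @` I2) = setT /\
    (forall i : I1, 0 < gam i) /\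
    (forall i : I1, V (val i) = cspan [set f i]) /\
    (forall i : I2, V (Some (val i)) = W (val i)) /\
    orthogonal_direct_sum ip
      (cspan (range (fun i : I1 => U (f i))))
      (cspan (\bigcup_(i in I2) (U @` W i))) /\
    ((frame_sequence ip (fun i : I1 => U (f i)) /\
      excess (fun i : I1 => U (f i)) 1 /\
      strictly_scalable ip (fun i : I1 => U (f i)) gam /\
      orthogonal_family ip (fun i : I2 => U @` W (val i)))
     \/
     (let M := cspan (range f) in
      let N := cspan (\bigcup_(i in I2) W i) in
      let SF := frame_operator ip (fun i : I1 => gam i *: f i) in
      let SW := fusion_frame_operator ip (fun i : I2 => W (val i)) (fun=> 1) in
      set_bij M M SF /\ set_bij N N SW /\
      (forall g, M g -> adjoint ip U (U g) = 'pinv_(fun=> 0) M SF g) /\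
      (forall i : I2,
         (fun g => adjoint ip U (U g)) @` W (val i) =
         'pinv_(fun=> 0) N SW @` W (val i))))).
Proof.
have Ks := base_field_scalars R k.
have [T T_cont [UK TK]] := U_inv.
have V_closed o : closed_subspace (V o) by case: V_frame => [[+ _] _]; apply.
have V_some i : V (Some i) = W i by rewrite V_def.
have x_neq0 : x != 0.
  by apply: (excess1_neq0 W_riesz); rewrite -V_def.
have {}x_sum : sums_to xs x.
  apply/(@sums_to_val _ _ _ [set i : I | xs i <> 0]) => [j /contrapT //|].
  exact/has_sumP.
split=> [[c]|].
  rewrite V_def => V_scal.
  have [I1 [I2 [f [gam [h1 [h2 [h3 [h4 [h5 h6]]]]]]]]] :=
    scalable_splits Ks ip_norm W_riesz xs_in x_sum x_neq0 U_cont T_cont UK TK V_scal.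
  exists I1, I2, f, gam; do 5![split=> //].
  by split=> //; left; case: h6 => ? [? [? ?]].
move=> [I1 [I2 [f [gam [disj [cover [gam0 [V_line [_ [dsum ab]]]]]]]]]].
have [strict orth] : strictly_scalable ip (fun i : I1 => U (f i)) gam /\
    orthogonal_family ip (fun i : I2 => U @` W (val i)).
  case: ab => [[_ [_ [? ?]]] //|[SF_bij [SW_bij [adjF adjW]]]]; split.
    exact: (strictly_scalable_of_adjoint Ks ip_norm U_cont T_cont UK TK gam0 SF_bij adjF).
  exact: (orthogonal_family_of_adjoint Ks ip_norm V_closed V_some U_cont W_riesz SW_bij adjW).
exact: (split_scalable Ks ip_norm V_closed V_some T_cont UK TK disj cover V_line dsum strict orth).
Qed.
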